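(* For every $n\in\mathbb N$, every penny graph on $n$ vertices in general position has at most $\frac{43n}{18}$ edges.
   Context: A penny graph is a graph whose vertex set is a finite set $P$ of points in the Euclidean plane such that every two distinct points of $P$ are at distance at least $1$, and whose edges are exactly the pairs of points of $P$ at distance exactly $1$ (so edges realize the minimum distance). The vertices are in general position if no three of them are collinear. *)

(* Defs.v *)
From HB Require Import structures.
From mathcomp Require Import all_boot all_order all_algebra.
From mathcomp Require Import finmap.
From mathcomp Require Import reals.

Set Implicit Arguments.
Unset Strict Implicit.
Unset Printing Implicit Defensive.

Import Order.TTheory GRing.Theory Num.Theory.

Local Open Scope fset_scope.
Local Open Scope ring_scope.

(** MathComp world.  The Euclidean plane is ['rV[R]_2] for [R : realType]. *)

(* Defined by hand because the library's norm on row vectors is the sup norm. *)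
Definition edist (R : realType) (p q : 'rV[R]_2) : R :=
  Num.sqrt (\sum_(i < 2) (p 0 i - q 0 i) ^+ 2).

Definition on_line (R : realType) (o v p : 'rV[R]_2) : Prop :=
  exists t : R, p = o + t *: v.

Definition collinear3 (R : realType) (p q r : 'rV[R]_2) : Prop :=
  exists o v : 'rV[R]_2,
    v != 0 /\ [/\ on_line o v p, on_line o v q & on_line o v r].

Definition general_position (R : realType) (P : {fset 'rV[R]_2}) : Prop :=
  forall p q r : 'rV[R]_2, p \in P -> q \in P -> r \in P ->
    p != q -> q != r -> p != r -> ~ collinear3 p q r.

(* A penny graph is determined by its vertex set [P], which must satisfy
   [penny_vertices P]; its edge set is [penny_edges P]. *)
Definition penny_vertices (R : realType) (P : {fset 'rV[R]_2}) : Prop :=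
  forall p q : 'rV[R]_2, p \in P -> q \in P -> p != q -> 1 <= edist p q.

(* Edges are unordered pairs [{p, q}], so each one is counted once; [p] and [q]
   are distinct because their distance is 1. *)
Definition penny_edges (R : realType) (P : {fset 'rV[R]_2}) :
    {fset {fset 'rV[R]_2}} :=
  [fset [fset p; q] | p in P, q in P & edist p q == 1].

(* Main.v *)
Require Import Defs.
From HB Require Import structures.
From mathcomp Require Import all_boot all_order all_algebra.
From mathcomp Require Import finmap.
From mathcomp Require Import zify ring lra.
From mathcomp Require Import boolp reals trigo.

Set Implicit Arguments.
Unset Strict Implicit.
Unset Printing Implicit Defensive.

Import Order.TTheory GRing.Theory Num.Theory.
Local Open Scope fset_scope.
Local Open Scope ring_scope.

(* Proof.  Vertices of degree at most 2 are removed by induction, since 2 <= 43/18;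
   a vertex of degree 6 would be the midpoint of two neighbours.  So assume all
   degrees are 3, 4 or 5, and measure angles in sixths of a full turn.

   Consider the corners of the graph, that is, the angles between cyclically
   consecutive edges at a vertex.  All of them are >= 1, with equality exactly for
   the corners of triangular faces.  Two consecutive angles of any other face add
   up to at least 3, with equality only in a rhombus, and a corner of angle [t]
   that is neither in a triangle nor in a rhombus has [2 t + t' + t'' >= 7], where
   [t'] and [t''] are its neighbours on the face.  Across each side of a face we
   move twice the difference of the angles at its two ends.  This turns
   [9 deg v - 43], whose sum is 18 e - 43 n, into the weight 5 plus the sum of the
   charges [9 - 4 t - 2 t' - 2 t''] of the corners of [v].  The charge is 1 for a
   triangle, -3 for a rhombus and at most -5 otherwise, so that only the vertices
   of degree 5 with two rhombi separating one triangle from two others are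
   positive, with weight 2.

   The weights are then collected on the triangles, where pairs of triangles with
   a common side (diamonds) are treated together, and each such cluster has total
   at most 0.  What makes positive vertices rare is collinearity: if x y and a c
   are parallel edges and so are y a and c r, with a path x, y, a, c, r, then [a]
   is the midpoint of x and r.  No planarity or Euler formula is used; everything
   is local. *)

(** * Charging corners *)

(** The transfer with factor 2 gives every corner of a rhombus with angles t and 3 - t the same
    charge 9 - 12 = -3, whatever its shape. The constant 5 is 48 - 43: the term 8 t adds up to 48
    around a vertex.

    The obstacle is the diamond at a positive vertex. Its tips should pay for the weight 2, but a
    tip may itself be a vertex of degree 5 with the same pattern, which has nothing to give, or a
    vertex of degree 4 whose negative weight is wanted by the diamonds at two opposite corners. Part
    of the weight 2 then goes to the isolated triangle at the positive vertex. [claimR] divides this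
    amount into two bills, one for each other corner of that triangle; the midpoint argument
    excludes bad combinations of bills. [kappa] settles the competition at a vertex of degree 4: an
    isolated triangle that lies in a diamond can bear more than one that does not.

    Every configuration also occurs reflected. The axioms of [angle_map] are invariant under
    reversal of the orientation, so that each case is treated once. *)

Definition sweep (R : realFieldType) (D : Type) (s : D -> D) (angle : D -> R)
    (c : D) (k : nat) : R :=
  \sum_(i < k) angle (iter i s c).

(* [s] turns around a vertex and [f] runs along a face.  Starting from the corner
   [c] between y -> a and the next edge at y, the turns [k], [l], [m] at y, a, c
   describe the path x, y, a, c, r of the midpoint argument. *)
Definition bent_path (R : realFieldType) (D : Type) (s f : D -> D)
    (angle : D -> R) (c : D) (k l m : nat) : Prop :=
  let c1 := s (f c) in let c2 := s (f (iter l s c1)) in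
  [/\ (0 < k)%N, (0 < m)%N, sweep s angle c k = sweep s angle c1 l
    & sweep s angle c1 l + sweep s angle c2 m = 6].

(* A corner is encoded by the dart [v -> a] that bounds it clockwise: [nxt] is the
   next corner counterclockwise at [v], [fnx] the next corner of the same face
   (at [a]), [prv] and [fpv] are their inverses, and [nxt \o fnx] reverses the
   dart.  [deg] is the degree of the vertex. *)
Record angle_map (R : realFieldType) (D : finType) := AngleMap {
  nxt : D -> D;
  prv : D -> D;
  fnx : D -> D;
  fpv : D -> D;
  deg : D -> nat;
  angle : D -> R;
  nxtK : cancel nxt prv;
  prvK : cancel prv nxt;
  fnxK : cancel fnx fpv;
  fpvK : cancel fpv fnx;
  edgeK : forall c, nxt (fnx (nxt (fnx c))) = c;
  deg_nxt : forall c, deg (nxt c) = deg c;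
  degP : forall c,
    [\/ [/\ deg c = 3%N, nxt (nxt c) = prv c
          & angle c + angle (nxt c) + angle (prv c) = 6],
        [/\ deg c = 4%N, nxt (nxt c) = prv (prv c)
          & angle c + angle (nxt c) + angle (prv c) + angle (nxt (nxt c)) = 6]
      | [/\ deg c = 5%N, nxt (nxt (nxt c)) = prv (prv c)
          & angle c + angle (nxt c) + angle (prv c) + angle (nxt (nxt c))
            + angle (prv (prv c)) = 6]];
  angle_ge1 : forall c, 1 <= angle c;
  angle_eq1 : forall c, angle c = 1 -> fnx (fnx (fnx c)) = c /\ angle (fnx c) = 1;
  angle_pair : forall c, angle c != 1 -> 3 <= angle c + angle (fnx c);
  angle_rhombus : forall c, angle c != 1 -> angle c + angle (fnx c) = 3 ->
    [/\ fnx (fnx (fnx (fnx c))) = c, angle (fnx (fnx c)) = angle c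
      & angle (fnx (fnx (fnx c))) = angle (fnx c)];
  angle_open : forall c, angle c != 1 -> angle c + angle (fnx c) != 3 ->
    7 <= 2 * angle c + angle (fnx c) + angle (fpv c);
  angle_fan : forall c, angle c = 1 -> angle (nxt c) = 1 -> angle (nxt (nxt c)) != 1;
  path_ccw : forall c k l m, ~ bent_path nxt fnx angle c k l m;
  path_cw : forall c k l m, ~ bent_path prv fpv angle c k l m
}.

(** * Reversal of the orientation *)

Section Mirror.
Context {R : realFieldType} {D : finType}.
Variable M : angle_map R D.
Notation s := (nxt M).
Notation si := (prv M).
Notation f := (fnx M).
Notation fi := (fpv M).

Lemma nxt_fnx c : s (f c) = fi (si c).
Proof. by rewrite -{2}(edgeK M c) nxtK fnxK. Qed.
Lemma fnx_nxt c : f (s c) = si (fi c).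
Proof. by rewrite -{1}(fpvK M c) -{2}(edgeK M (fi c)) nxtK (fpvK M). Qed.
Lemma fpv_prv c : fi (si c) = s (f c).
Proof. by rewrite nxt_fnx. Qed.

Lemma mirror_edgeK c : si (fi (si (fi c))) = c.
Proof. by rewrite fpv_prv nxtK fpvK. Qed.
Lemma prv_deg c : deg M (si c) = deg M c.
Proof. by rewrite -{2}(prvK M c) deg_nxt. Qed.

Lemma mirror_degP c :
    [\/ [/\ deg M c = 3%N, si (si c) = s c
          & angle M c + angle M (si c) + angle M (s c) = 6],
        [/\ deg M c = 4%N, si (si c) = s (s c)
          & angle M c + angle M (si c) + angle M (s c) + angle M (si (si c)) = 6]
      | [/\ deg M c = 5%N, si (si (si c)) = s (s c)
          & angle M c + angle M (si c) + angle M (s c) + angle M (si (si c))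
            + angle M (s (s c)) = 6]].
Proof.
have [[-> e <-]|[-> e <-]|[-> e <-]] := degP M c.
- constructor 1; split=> //; last by ring.
  by rewrite -e nxtK.
- constructor 2; split=> //; rewrite -e; ring.
- constructor 3; split=> //; last by rewrite -e; ring.
  by rewrite -e !nxtK.
Qed.

Lemma angle_fpv1 c : angle M c = 1 -> angle M (fi c) = 1.
Proof.
move=> h; have [e h1] := angle_eq1 h; have [_ h2] := angle_eq1 h1.
by rewrite -{1}e fnxK.
Qed.

Lemma mirror_angle_eq1 c : angle M c = 1 -> fi (fi (fi c)) = c /\ angle M (fi c) = 1.
Proof.
move=> h; split; last exact: angle_fpv1.
have [e _] := angle_eq1 h; by rewrite -{1}e !fnxK.
Qed.

Lemma angle_fpvN1 c : angle M c != 1 -> angle M (fi c) != 1.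
Proof.
apply: contra => /eqP h; apply/eqP.
by have [_] := angle_eq1 h; rewrite fpvK.
Qed.

Lemma mirror_angle_pair c : angle M c != 1 -> 3 <= angle M c + angle M (fi c).
Proof.
move=> /angle_fpvN1 /angle_pair; rewrite fpvK; lra.
Qed.

Lemma rhombus_fpv c : angle M c != 1 -> angle M c + angle M (f c) = 3 ->
  angle M (fi c) = angle M (f c).
Proof.
move=> h1 h2; have [e _ <-] := angle_rhombus h1 h2.
by rewrite -{1}e fnxK.
Qed.

Lemma rhombus_fnx c : angle M c != 1 -> angle M c + angle M (fi c) = 3 ->
  angle M (f c) = angle M (fi c).
Proof.
move=> h1 h2; have [||e e2 e3] := @angle_rhombus _ _ M (fi c).
- exact: angle_fpvN1.
- by rewrite fpvK addrC.
by move: e2; rewrite fpvK.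
Qed.

Lemma mirror_angle_rhombus c : angle M c != 1 -> angle M c + angle M (fi c) = 3 ->
    [/\ fi (fi (fi (fi c))) = c, angle M (fi (fi c)) = angle M c
      & angle M (fi (fi (fi c))) = angle M (fi c)].
Proof.
move=> h1 h2; have h3 := rhombus_fnx h1 h2.
have [|e e2 e3] := @angle_rhombus _ _ M c h1; first by rewrite h3.
have e' : fi (fi (fi (fi c))) = c by rewrite -{1}e !fnxK.
split=> //; first by rewrite -{1}e !fnxK.
by rewrite -h3 -{1}e !fnxK.
Qed.

Lemma mirror_angle_open c : angle M c != 1 -> angle M c + angle M (fi c) != 3 ->
  7 <= 2 * angle M c + angle M (fi c) + angle M (f c).
Proof.
move=> h1 h2.
have h3 : angle M c + angle M (f c) != 3.
  apply: contra h2 => /eqP h2; by rewrite (rhombus_fpv h1 h2) h2.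
have := angle_open h1 h3; lra.
Qed.

Lemma mirror_angle_fan c : angle M c = 1 -> angle M (si c) = 1 ->
  angle M (si (si c)) != 1.
Proof.
move=> h1 h2; apply/eqP => h3; have := @angle_fan _ _ M (si (si c)) h3.
by rewrite !prvK h1 h2 eqxx => /(_ erefl).
Qed.

(** Corners are kept, but the encoding dart of a corner now plays the role of its counterclockwise
    side. The rotations are exchanged with their inverses, and the two path axioms with each
    other. *)
Definition mirror : angle_map R D :=
  AngleMap (prvK M) (nxtK M) (fpvK M) (fnxK M) mirror_edgeK prv_deg mirror_degP
    (angle_ge1 M) mirror_angle_eq1 mirror_angle_pair mirror_angle_rhombus
      mirror_angle_open
    mirror_angle_fan (@path_cw _ _ M) (@path_ccw _ _ M).

End Mirror.

(** * Charges, weights and their distribution over triangle corners *)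

Section Charge.
Context {R : realFieldType} {D : finType}.
Variable M : angle_map R D.
Notation s := (nxt M).
Notation si := (prv M).
Notation f := (fnx M).
Notation fi := (fpv M).

(* [split5 c]: the corners at a vertex of degree 5 are, from [c] on, triangle,
   other, triangle, triangle, other; [rich] vertices are those of weight 2.
   [tipR c] is the corner, in the two triangles facing [c], at the tip on the
   clockwise side of [c].  The suffix R marks notions that depend on
   the orientation; their other versions are obtained from [mirror M]. *)
Definition tri c := angle M c == 1.
Definition rhomb c := ~~ tri c && (angle M c + angle M (f c) == 3).
Definition charge c := 9 - 4 * angle M c - 2 * angle M (f c) - 2 * angle M (fi c).
(** Only the degrees 3, 4 and 5 occur, so the corners at a vertex can be listed. *)
Definition vertex_sum (g : D -> R) c := g c + g (s c) + g (si c)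
  + (if deg M c == 4%N then g (s (s c))
     else if deg M c == 5%N then g (s (s c)) + g (si (si c)) else 0).
Definition weight c := 5 + vertex_sum charge c.
Definition split5 c := [&& deg M c == 5%N, tri c, tri (s (s c)) & tri (si (si c))].
Definition rich c := [&& split5 c, rhomb (s c) & rhomb (si c)].
Definition tipR c := fi (si (si c)).
(** [a'] lies at the other end of the common side of the diamond facing [l]. In this configuration
    that end has weight up to 0, and the diamond may need the whole weight of its tip of degree
    4. *)
Definition needR l := let a' := f (si (si l)) in
  [&& deg M (tipR l) == 4%N, tri (s (s (tipR l))), split5 (si (si a'))
    & rhomb (s (s a'))].
(** [s (fi (si t))] is the only corner with [tipR] equal to [t]. *)
Definition needyR t := let l := s (fi (si t)) in rich l && needR l.
(** The test is made at the corner opposite to [t] in the rhombus beside it. When two diamonds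
    compete for [t], it says that the isolated triangle of the positive vertex has another triangle
    across the side facing that vertex, hence lies in a diamond. *)
Definition acrossR t := rhomb (si t) && tri (si (si (fi (fi (si t))))).

End Charge.

Section Share.
Context {R : realFieldType} {D : finType}.
Variable M : angle_map R D.
Notation s := (nxt M).
Notation M' := (mirror M).

Definition needy t := needyR M t || needyR M' t.
Definition across t := acrossR M t || acrossR M' t.
(* The fraction of the negative weight of a degree-4 vertex with two opposite
   triangles that goes to the triangle of [t]. *)
Definition kappa t : R := let t2 := s (s t) in
  if needy t then
    if needy t2 then
      if across t then (if across t2 then 2^-1 else 0)
      else if across t2 then 1 else 2^-1
    else 1
  else if needy t2 then 0 else 2^-1.
(** What the diamond facing [l] wants from its tip of degree 4 and does not get; it is passed on to
    the isolated triangle. *)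
Definition excessR l : R := if rich M l && needR M l then 1 - kappa (tipR M l) else 0.
End Share.

Section Claim.
Context {R : realFieldType} {D : finType}.
Variable M : angle_map R D.
Notation M' := (mirror M).
(** The bill sent to the corner [fnx l] of the isolated triangle. The unit due to the far tip is
    combined with the excess at the near tip because whether [nxt (nxt (fnx l))] is a triangle
    decides which of the two can be nonzero. *)
Definition claimR l : R :=
  if rich M l then (if split5 M (tipR M' l) then 1 else 0) + excessR M l else 0.
End Claim.

Section Payout.
Context {R : realFieldType} {D : finType}.
Variable M : angle_map R D.
Notation s := (nxt M).
Notation si := (prv M).
Notation M' := (mirror M).
(* The weight of a split5 vertex is given to its pair of triangles, except for
   the [payout] which goes to the isolated triangle. *)
Definition payout l : R := claimR M l + claimR M' l.
(** In the first two cases the argument of [payout] is the isolated corner if the vertex has the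
    pattern of [split5]; otherwise the payout vanishes and the pair receives the whole weight. *)
Definition share c : R :=
  if tri M (s c) then (weight M c - payout (si (si c))) / 2
  else if tri M (si c) then (weight M c - payout (s (s c))) / 2
  else if split5 M c then payout c
  else if (deg M c == 5%N) && (tri M (s (s c)) || tri M (si (si c))) then
    weight M c / 2
  else if (deg M c == 4%N) && tri M (s (s c)) then kappa M c * weight M c
  else weight M c.
End Payout.

(** * Invariance under reflection, and the values of the charge *)

Section MirrorInvariance.
Context {R : realFieldType} {D : finType}.
Variable M : angle_map R D.
Notation s := (nxt M).
Notation si := (prv M).
Notation f := (fnx M).
Notation fi := (fpv M).
Notation M' := (mirror M).
Notation angle := (angle M).

Lemma rhomb_fpv c : rhomb M c -> [/\ rhomb M (fi c), angle (fi c) = 3 - angle c,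
   angle (f c) = 3 - angle c & fi (fi c) = f (f c)].
Proof.
case/andP=> h1 /eqP h2.
have h3 := rhombus_fpv h1 h2.
have [e _ _] := angle_rhombus h1 h2.
split; last by rewrite -{1}e !fnxK.
- rewrite /rhomb /tri angle_fpvN1 //= fpvK h3; apply/eqP; lra.
- lra.
- lra.
Qed.

Lemma rhomb_mirror c : rhomb M' c = rhomb M c.
Proof.
apply/idP/idP => /andP[h1 /eqP h2]; rewrite /rhomb h1 /=; apply/eqP.
- have h3 : angle c + angle (fi c) = 3 by exact: h2.
  by rewrite (@rhombus_fnx _ _ M c h1 h3).
- by rewrite (rhombus_fpv h1 h2).
Qed.

Lemma charge_mirror c : charge M' c = charge M c.
Proof. rewrite /charge /=; ring. Qed.

Lemma weight_mirror c : weight M' c = weight M c.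
Proof.
rewrite /weight /vertex_sum !charge_mirror /=.
case: (degP M c) => [[-> e _]|[-> e _]|[-> e _]] /=; rewrite ?e; ring.
Qed.

Lemma split5_mirror c : split5 M' c = split5 M c.
Proof. by rewrite /split5 /=; congr (_ && (_ && _)); rewrite andbC. Qed.

Lemma rich_mirror c : rich M' c = rich M c.
Proof. by rewrite /rich split5_mirror !rhomb_mirror /= [X in _ && X]andbC. Qed.

Lemma needy_mirror t : needy M' t = needy M t.
Proof. by rewrite /needy orbC. Qed.
Lemma across_mirror t : across M' t = across M t.
Proof. by rewrite /across orbC. Qed.

Lemma tipR_opp t : tipR M (s (fi (si t))) = t.
Proof.
rewrite /tipR nxtK; apply: (can_inj (prvK M)).
by rewrite mirror_edgeK.
Qed.
Lemma needyR_deg4 t : needyR M t -> deg M t = 4%N.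
Proof. by case/andP=> _ /and4P[/eqP + _ _ _]; rewrite tipR_opp. Qed.

End MirrorInvariance.

Section CornerFacts.
Context {R : realFieldType} {D : finType}.
Variable M : angle_map R D.
Notation s := (nxt M).
Notation si := (prv M).
Notation f := (fnx M).
Notation fi := (fpv M).
Notation M' := (mirror M).
Notation angle := (angle M).

Lemma needy_deg4 t : needy M t -> deg M t = 4%N.
Proof. by case/orP; [exact: needyR_deg4 | move/needyR_deg4]. Qed.

Lemma deg4_opp t : deg M t = 4%N -> s (s t) = si (si t).
Proof. by case: (degP M t) => [[-> ]|[_ -> _]|[->]]. Qed.

Lemma kappa_mirror t : kappa M' t = kappa M t.
Proof.
rewrite /kappa !needy_mirror !across_mirror /=.
case: (boolP (deg M t == 4%N)) => [/eqP/deg4_opp -> //|h].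
have -> : needy M t = false by apply/negP => /needy_deg4 e; rewrite e in h.
have -> : needy M (s (s t)) = false.
  by apply/negP => /needy_deg4; rewrite !deg_nxt => e; rewrite e in h.
have -> // : needy M (si (si t)) = false.
by apply/negP => /needy_deg4; rewrite !prv_deg => e; rewrite e in h.
Qed.

Lemma payout_mirror l : payout M' l = payout M l.
Proof. by rewrite /payout addrC. Qed.

Lemma tri_fan c : tri M c -> tri M (s c) -> tri M (s (s c)) = false.
Proof. by move=> /eqP h1 /eqP h2; apply/negbTE/angle_fan. Qed.

Lemma share_mirror c : tri M c -> share M' c = share M c.
Proof.
move=> hT; rewrite /share weight_mirror split5_mirror !payout_mirror kappa_mirror /=.
rewrite -/(tri M' (si c)) -/(tri M' (s c)).
change (tri M' (si c)) with (tri M (si c)); change (tri M' (s c)) with (tri M (s c)).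
case: ifP => h1.
  case: ifP => // h2.
  by have := tri_fan h1; rewrite prvK hT => /(_ isT); rewrite h2.
case: ifP => //= h2; case: ifP => // h3; rewrite orbC; case: ifP => // h4.
case: (boolP (deg M c == 4%N)) => //= /eqP/deg4_opp -> //.
Qed.

Lemma side_gt1 c : ~~ tri M c -> 1 < angle c.
Proof. by move=> h; rewrite lt_neqAle eq_sym h angle_ge1. Qed.

Lemma tri_fnx c : tri M (f c) = tri M c.
Proof.
apply/idP/idP => /eqP h; apply/eqP.
- by have := angle_fpv1 h; rewrite fnxK.
- by have [] := angle_eq1 h.
Qed.
Lemma tri_fpv c : tri M (fi c) = tri M c.
Proof. by rewrite -{2}(fpvK M c) tri_fnx. Qed.
Lemma tri_ff c : tri M c -> f (f c) = fi c.
Proof. by move=> /eqP h; have [e _] := angle_eq1 h; rewrite -{2}e fnxK. Qed.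
Lemma tri_fifi c : tri M c -> fi (fi c) = f c.
Proof. by move=> h; rewrite -tri_ff ?tri_fpv // fpvK. Qed.

Lemma charge_tri c : tri M c -> charge M c = 1.
Proof.
move=> h; have := h; rewrite -tri_fnx => /eqP h1; have := h.
by rewrite -tri_fpv => /eqP h2; rewrite /charge h1 h2 (eqP h); ring.
Qed.
Lemma charge_rhomb c : rhomb M c -> charge M c = -3.
Proof. by case/rhomb_fpv=> _ e1 e2 _; rewrite /charge e1 e2; ring. Qed.
Lemma charge_open c : ~~ tri M c -> ~~ rhomb M c -> charge M c <= -5.
Proof.
rewrite /rhomb => h1; rewrite h1 /= => h2.
have := angle_open h1 h2; rewrite /charge; lra.
Qed.
Lemma charge_side c : ~~ tri M c -> charge M c <= -3.
Proof.
move=> h1; case: (boolP (rhomb M c)) => [/charge_rhomb ->//|/(charge_open h1)]; lra.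
Qed.
Lemma charge_le c : charge M c <= 5 - 4 * angle c.
Proof. rewrite /charge; have := angle_ge1 M (f c); have := angle_ge1 M (fi c);
  lra. Qed.
Lemma rhomb_side c : rhomb M c -> ~~ tri M c. Proof. by case/andP. Qed.
Lemma rhomb_lt2 c : rhomb M c -> angle c < 2.
Proof.
case/rhomb_fpv=> /rhomb_side /side_gt1 h e1 _ _; lra.
Qed.
Lemma rhomb_gt1 c : rhomb M c -> 1 < angle c.
Proof. by move/rhomb_side/side_gt1. Qed.
Lemma rhomb_fnx c : rhomb M c -> rhomb M (f c).
Proof. by rewrite -!(rhomb_mirror M) => /rhomb_fpv[]. Qed.
Lemma sideP c : ~~ tri M c ->
  rhomb M c /\ angle (f c) = 3 - angle c \/ ~~ rhomb M c /\ 3 < angle c + angle (f c).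
Proof.
move=> h; case: (boolP (rhomb M c)) => [h1|h1]; [left|right]; split=> //.
  by case/rhomb_fpv: h1.
move: h1; rewrite /rhomb h /= => h1.
by rewrite lt_neqAle eq_sym h1 angle_pair.
Qed.

End CornerFacts.

(** * Summation over the corners of a vertex *)

Section Vertex.
Context {R : realFieldType} {D : finType}.
Variable M : angle_map R D.
Notation s := (nxt M).
Notation si := (prv M).

Lemma vertex_sum_nxt (g : D -> R) c : vertex_sum M g (s c) = vertex_sum M g c.
Proof.
rewrite /vertex_sum deg_nxt nxtK.
case: (degP M c) => [[-> e _]|[-> e _]|[-> e _]] /=.
- by rewrite e; ring.
- by rewrite !e !prvK; ring.
- by rewrite e; ring.
Qed.
Lemma vertex_sum_prv (g : D -> R) c : vertex_sum M g (si c) = vertex_sum M g c.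
Proof. by rewrite -{2}(prvK M c) vertex_sum_nxt. Qed.
Lemma weight_nxt c : weight M (s c) = weight M c. Proof. by rewrite /weight
  vertex_sum_nxt. Qed.
Lemma weight_prv c : weight M (si c) = weight M c. Proof. by rewrite /weight
  vertex_sum_prv. Qed.

Lemma deg_gt0 c : (deg M c)%:R != 0 :> R.
Proof. by case: (degP M c) => [[-> _ _]|[-> _ _]|[-> _ _]]; rewrite pnatr_eq0. Qed.

Lemma sum_nxt (h : D -> R) : \sum_c h (s c) = \sum_c h c.
Proof. by rewrite [RHS](reindex_inj (can_inj (nxtK M))). Qed.
Lemma sum_prv (h : D -> R) : \sum_c h (si c) = \sum_c h c.
Proof. by rewrite [RHS](reindex_inj (can_inj (prvK M))). Qed.

(** Double counting: a corner occurs once in the vertex sum of each of the [deg] corners at its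
    vertex. *)
Lemma sum_vertex_sum (g : D -> R) :
  \sum_c vertex_sum M g c / (deg M c)%:R = \sum_c g c.
Proof.
pose h c := g c / (deg M c)%:R.
(* The degree tests are moved into the summands, so that every rotation is a reindexing of a full
   sum. *)
pose h4 c := if deg M c == 4%N then h c else 0.
pose h5 c := if deg M c == 5%N then h c else 0.
transitivity (\sum_c (h c + h (s c) + h (si c) + h4 (s (s c))
   + h5 (s (s c)) + h5 (si (si c)))).
  apply: eq_bigr => c _.
  rewrite /vertex_sum /h4 /h5 /h !deg_nxt !prv_deg.
  case: (degP M c) => [[-> e _]|[-> e _]|[-> e _]] /=; ring.
rewrite !big_split /= !sum_nxt !sum_prv (sum_nxt (fun c => h4 (s c))) sum_nxt.
rewrite (sum_nxt (fun c => h5 (s c))) sum_nxt (sum_prv (fun c => h5 (si c))) sum_prv.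
rewrite -!big_split /=; apply: eq_bigr => c _.
have := deg_gt0 c; rewrite /h4 /h5 /h.
case: (degP M c) => [[-> e _]|[-> e _]|[-> e _]] /= hd; field; rewrite ?pnatr_eq0 //.
Qed.

Lemma sum_vertex_sum_le0 (g : D -> R) : (forall c, vertex_sum M g c <= 0) ->
  \sum_c g c <= 0.
Proof.
move=> h; rewrite -sum_vertex_sum sumr_le0 // => c _.
by rewrite mulr_le0_ge0 ?invr_ge0 ?ler0n.
Qed.

Lemma payout_nrich l : ~~ rich M l -> payout M l = 0.
Proof.
by move=> h; rewrite /payout /claimR rich_mirror (negbTE h) addr0.
Qed.

Definition trishare c := if tri M c then share M c else 0.

Lemma rich_deg5 c : rich M c -> deg M c = 5%N.
Proof. by case/and3P => /and4P[/eqP]. Qed.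

Lemma tri_back c : tri M c -> tri M (s c) -> tri M (si c) = false.
Proof.
move=> h1 h2; apply/negP => h3; have := @tri_fan _ _ M (si c) h3.
by rewrite prvK h2 => /(_ h1).
Qed.

(** The payout withheld from the pair is what the isolated triangle of the same vertex receives. *)
Lemma vertex_share_pair c : tri M c -> tri M (s c) ->
  weight M c <= vertex_sum M trishare c.
Proof.
move=> h1 h2; have h3 := tri_fan h1 h2; have h4 := tri_back h1 h2.
rewrite /vertex_sum /trishare h1 h2 h4 h3 /share h2 nxtK h1 h3 weight_nxt.
case: (degP M c) => [[d e _]|[d e _]|[d e _]]; rewrite d /=.
- rewrite !payout_nrich; first by lra.
    by apply/negP => /rich_deg5; rewrite !deg_nxt d.
  by apply/negP => /rich_deg5; rewrite !prv_deg d.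
- rewrite !payout_nrich; first by lra.
    by apply/negP => /rich_deg5; rewrite !deg_nxt d.
  by apply/negP => /rich_deg5; rewrite !prv_deg d.
- rewrite e; case: ifP => h5; last first.
    rewrite !payout_nrich; first by lra.
    by apply/negP => /and3P[/and4P[_]]; rewrite h5.
  have e2 : si (si (si c)) = s (s c) by rewrite -e !nxtK.
  rewrite !prvK h4 e2 h3 /split5 !prv_deg d h5 !prvK h1 e2 nxtK h2 /=; lra.
Qed.

Lemma kappaD c : deg M c = 4%N -> kappa M c + kappa M (s (s c)) = 1.
Proof.
move=> d; rewrite /kappa.
have -> : s (s (s (s c))) = c by rewrite (deg4_opp d) !prvK.
by case: (needy M c); case: (needy M (s (s c))); case: (across M c);
  case: (across M (s (s c)));
  rewrite /=; field.
Qed.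

Lemma vertex_share_lone c : tri M c -> ~~ tri M (s c) -> ~~ tri M (si c) ->
  (forall c', tri M c' -> tri M (s c') -> weight M c' <= vertex_sum M trishare c') ->
  weight M c <= vertex_sum M trishare c.
Proof.
move=> h1 /negbTE h2 /negbTE h3 hp.
case: (boolP (split5 M c)) => [h|hT3].
  case/and4P: h => [/eqP d _ h4 h5].
  have e : s (s (s c)) = si (si c).
    by case: (degP M c) => [[]|[]|[]]; rewrite d.
  have := hp (s (s c)) h4; rewrite e h5 => /(_ isT).
  by rewrite !weight_nxt !vertex_sum_nxt.
rewrite /vertex_sum /trishare h1 h2 h3 /share h2 h3 (negbTE hT3).
case: (degP M c) => [[d e _]|[d e _]|[d e _]]; rewrite d /=; first by lra.
- case: ifP => h4; last by lra.
  have e2 : s (s (s c)) = si c by rewrite e prvK.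
  rewrite e2 h3 nxtK h2 /split5 !deg_nxt d /= prvK h1 !weight_nxt.
  have := kappaD d; move: (kappa _ _) (kappa _ _) => x y hxy.
  have -> : y = 1 - x by lra.
  lra.
- have e2 : si (si (si c)) = s (s c) by rewrite -e !nxtK.
  move: hT3; rewrite /split5 d h1 /= => hT3.
  case: (boolP (tri M (s (s c)))) hT3 => h4 /= h5.
    rewrite e (negbTE h5) !nxtK h2 !deg_nxt d !prvK h3 h1 /= !weight_nxt; lra.
  case: ifP => h6; last by lra.
  rewrite !prvK h3 e2 (negbTE h4) !prv_deg d nxtK h2 h1 /= !weight_prv; lra.
Qed.

Lemma vertex_share_tri c : tri M c -> weight M c <= vertex_sum M trishare c.
Proof.
move=> h1; case: (boolP (tri M (s c))) => h2; first exact: vertex_share_pair.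
case: (boolP (tri M (si c))) => h3.
  have := @vertex_share_pair (si c) h3; rewrite prvK => /(_ h1).
  by rewrite weight_prv vertex_sum_prv.
by apply: vertex_share_lone => // c'; exact: vertex_share_pair.
Qed.

(** A vertex without triangles has weight at most 5 - 9, so nothing positive is lost by giving
    weights to triangles only. *)
Lemma vertex_share c : weight M c <= vertex_sum M trishare c.
Proof.
case: (boolP (tri M c)) => h0; first exact: vertex_share_tri.
case: (boolP (tri M (s c))) => h1.
  by have := vertex_share_tri h1; rewrite weight_nxt vertex_sum_nxt.
case: (boolP (tri M (si c))) => h2.
  by have := vertex_share_tri h2; rewrite weight_prv vertex_sum_prv.
case: (boolP (tri M (s (s c)))) => h3.
  by have := vertex_share_tri h3; rewrite !weight_nxt !vertex_sum_nxt.
case: (boolP (tri M (si (si c)))) => h4.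
  by have := vertex_share_tri h4; rewrite !weight_prv !vertex_sum_prv.
rewrite /weight /vertex_sum /trishare (negbTE h0) (negbTE h1) (negbTE h2)
  (negbTE h3) (negbTE h4).
have := charge_side h0; have := charge_side h1; have := charge_side h2;
  have := charge_side h3; have := charge_side h4.
case: (degP M c) => [[-> e _]|[-> e _]|[-> e _]] /=; lra.
Qed.

End Vertex.

(** * Configurations excluded by collinearity *)

Section Paths.
Context {R : realFieldType} {D : finType}.
Variable M : angle_map R D.
Notation s := (nxt M).
Notation si := (prv M).
Notation f := (fnx M).
Notation fi := (fpv M).
Notation M' := (mirror M).
Notation angle := (angle M).

Lemma sweep2 c : sweep s angle c 2 = angle c + angle (s c).
Proof. by rewrite /sweep !big_ord_recr big_ord0 /= add0r. Qed.
Lemma sweep3 c : sweep s angle c 3 = angle c + angle (s c) + angle (s (s c)).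
Proof. by rewrite /sweep !big_ord_recr big_ord0 /= add0r. Qed.

Lemma split5P l : split5 M l ->
  [/\ tri M l, tri M (s (s l)), tri M (si (si l)), s (s (s l)) = si (si l)
    & [/\ ~~ tri M (s l), ~~ tri M (si l) & angle (s l) + angle (si l) = 3]].
Proof.
case/and4P=> /eqP d h1 h2 h3.
case: (degP M l) => [[]|[]|[_ e hs]]; [by rewrite d|by rewrite d|].
split=> //; split.
- by apply/negP => h; have := tri_fan h1 h; rewrite h2.
- by apply/negP => h; have := tri_fan h3; rewrite !prvK h h1 => /(_ isT).
- move: hs; rewrite (eqP h1) (eqP h2) (eqP h3); lra.
Qed.

Lemma rich_split5 l : rich M l -> split5 M l. Proof. by case/and3P. Qed.
Lemma rich_rhomb l : rich M l -> rhomb M (s l). Proof. by case/and3P. Qed.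
Lemma rich_rhomb' l : rich M l -> rhomb M (si l). Proof. by case/and3P. Qed.

Lemma fsf c : f (s (f c)) = si c.
Proof. by rewrite nxt_fnx fpvK. Qed.
(** Otherwise the vertex of [l] is a midpoint. The path turns at the end of [l] by a rhombus and a
    triangle, at the vertex of [l] by a triangle and a rhombus of the same angle, and at the
    counterclockwise tip by a rhombus and two triangles. *)
Lemma tri_outer l : rich M l -> split5 M (tipR M' l) -> ~~ tri M (s (s (f l))).
Proof.
move=> hF ht; apply/negP => hT.
have [h1 h2 h3 e [h5 h6 h7]] := split5P (rich_split5 hF).
have R1 := rich_rhomb hF; have R2 := rich_rhomb' hF.
have [t1 t2 t3 te [t5 t6 t7]] := split5P ht.
have [_ e1 e2 _] := rhomb_fpv R1.
have [_ e3 e4 _] := rhomb_fpv R2.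
apply: (@path_ccw _ _ M (s (f l)) 2 2 3); split=> //.
  rewrite edgeK !sweep2 (eqP hT) (eqP h1).
  have -> : s (f l) = fi (si l) by rewrite nxt_fnx.
  rewrite e3; lra.
rewrite edgeK /= sweep2 sweep3.
rewrite /tipR /= in t1 t2 t3 te t7.
rewrite te (eqP t2) (eqP t3) (eqP h1).
have -> : angle (s (f (s (s l)))) = 3 - angle (s l) by rewrite nxt_fnx nxtK e1.
lra.
Qed.

(** Here two corners of one isolated triangle are at positive vertices. The midpoint is the vertex
    of [fi l]; the path comes from the vertex of [f l], where it passes triangle, rhombus, triangle,
    and ends at the tip. *)
Lemma path_split_tip l : rich M l -> tri M (s (s (f l))) -> rich M (fi l) ->
  ~ split5 M (tipR M (fi l)).
Proof.
move=> hF hT hF1 ht.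
have [h1 h2 h3 e [h5 h6 h7]] := split5P (rich_split5 hF).
have [j1 j2 j3 je [j5 j6 j7]] := split5P (rich_split5 hF1).
have [t1 t2 t3 te [t5 t6 t7]] := split5P ht.
have [_ e1 e2 _] := rhomb_fpv (rich_rhomb hF).
have [_ e3 e4 _] := rhomb_fpv (rich_rhomb' hF).
have [_ e5 e6 _] := rhomb_fpv (rich_rhomb' hF1).
have q1 : s (f (f l)) = s (fi l) by rewrite tri_ff.
have q2 : si (fi l) = f (s l) by rewrite fnx_nxt.
apply: (@path_ccw _ _ M (f l) 3 3 2); split=> //.
  rewrite q1 !sweep3 (eqP hT) (eqP j2) je (eqP j3).
  have -> : angle (f l) = 1 by apply/eqP; rewrite -/(tri _ _) tri_fnx.
  rewrite nxt_fnx e3; rewrite q2 in j7; lra.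
rewrite q1 /= sweep2 sweep3 (eqP j2) je (eqP j3) prvK.
have -> : s (f (si (fi l))) = tipR M (fi l) by rewrite nxt_fnx.
rewrite (eqP t1).
have q3 : si (tipR M (fi l)) = f (si (fi l)).
  by rewrite /tipR -fnx_nxt prvK.
rewrite q3 e6 in t7; lra.
Qed.

(** The midpoint is the vertex of [m]: the path comes from the vertex of [z] along a side of the
    rhombus and leaves along the common side of the diamond, to the vertex of [f m]. *)
Lemma path_doubled_apex m : let l := fi m in let z := si (f (f (si l))) in
  rich M l -> rich M z -> split5 M (s (s m)) -> tri M (si m) ->
  ~ split5 M (si (si (f m))).
Proof.
move=> l z hF hz ha hm hb.
have [h1 h2 h3 e [h5 h6 h7]] := split5P (rich_split5 hF).
have [z1 z2 z3 ze [z5 z6 z7]] := split5P (rich_split5 hz).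
have [a1 a2 a3 ae [a5 a6 a7]] := split5P ha.
have [b1 b2 b3 be [b5 b6 b7]] := split5P hb.
have [_ e1 e2 _] := rhomb_fpv (rich_rhomb hF).
have [_ e3 e4 eopp] := rhomb_fpv (rich_rhomb' hF).
have R2 : rhomb M (f (si l)) by apply/rhomb_fnx/rich_rhomb'.
have [_ e5 e6 _] := rhomb_fpv R2.
have R3 := rhomb_fnx R2.
have [_ e7 e8 _] := rhomb_fpv R3.
have q0 : f l = m by rewrite /l fpvK.
have q1 : f (f (f (si l))) = s m.
  rewrite -eopp fpvK -q0 nxt_fnx //.
have q2 : s (s (s (s (s m)))) = m by rewrite ae !nxtK.
have q3 : s (s (s (s m))) = si m by rewrite -[LHS](nxtK M) q2.
have Tm : tri M m by rewrite -q0 tri_fnx.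
have b0 : s (s (s (si (si (f m))))) = s (f m) by rewrite !prvK.
apply: (@path_ccw _ _ M (f (f (si l))) 3 3 2); split=> //.
  have zz : s z = f (f (si l)) by rewrite /z prvK.
  rewrite zz in z2 ze.
  rewrite q1 !sweep3 (eqP a1) q3 (eqP hm) (eqP z2) ze (eqP z3).
  have -> : angle (f (f (si l))) = angle (si l) by rewrite e6 e4; ring.
  have q5 : angle (s m) = 3 - angle (si l) by rewrite -q1 e8 e6 e4; ring.
  rewrite nxtK q5 in a7; lra.
rewrite q1 sweep3 /= q2 sweep2 (eqP a1) q3 (eqP hm).
have b8 : s (f m) = si (si (si (si (f m)))) by rewrite -be !prvK.
have q4 : angle (si (f m)) = 3 - angle (s l).
  by rewrite -e2 fnx_nxt /l tri_fifi.
have -> : angle (s (s (f m))) = 3 - angle (si (f m)).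
  by rewrite b8 prvK; rewrite prvK in b7; lra.
rewrite b8 (eqP b3) q4.
have q5 : angle (s m) = 3 - angle (si l) by rewrite -q1 e8 e6 e4; ring.
rewrite nxtK q5 in a7; lra.
Qed.

End Paths.

(** * Single triangles *)

Section Tips.
Context {R : realFieldType} {D : finType}.
Variable M : angle_map R D.
Notation s := (nxt M).
Notation si := (prv M).
Notation f := (fnx M).
Notation angle := (angle M).

Lemma kappa_ge0 t : 0 <= kappa M t.
Proof. by rewrite /kappa; do ! case: ifP => _; rewrite ?invr_ge0. Qed.
Lemma kappa_le1 t : kappa M t <= 1.
Proof. rewrite /kappa; do ! case: ifP => _; lra. Qed.

(** The bound -1 is (5 + 2 - 9) / 2, for two nonadjacent triangles in degree 5. If S = 3 the degree
    is 4 and the last angle is 2, too large for a rhombus, so the weight is at most 6 - 3 - 3 - 5.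
    The value 4 stands apart because in degree 4 it makes the last corner a triangle, which competes
    for the weight. *)
Lemma tipP t : tri M t -> ~~ tri M (s t) -> ~~ tri M (si t) -> ~~ split5 M t ->
  let S := angle (s t) + angle (si t) in
  [\/ [/\ S < 3, share M t <= -1
         & ~~ rhomb M (s t) || ~~ rhomb M (si t) -> share M t <= -2],
      S = 3 /\ share M t <= -5,
      [/\ 3 < S, S <> 4 & share M t <= -3]
    | [/\ S = 4, deg M t = 4%N, tri M (s (s t)), share M t = kappa M t * weight M t
         & weight M t <= -1 /\ (~~ rhomb M (s t) -> ~~ rhomb M (si t) ->
           weight M t <= -3)]].
Proof.
move=> h1 h2 h3 h4 S.
have := charge_tri h1; have := charge_side h2; have := charge_side h3.
have := side_gt1 h2; have := side_gt1 h3.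
rewrite /share (negbTE h2) (negbTE h3) (negbTE h4) => g3 g2 o3 o2 o1.
have hP : ~~ rhomb M (s t) || ~~ rhomb M (si t) ->
  charge M (s t) + charge M (si t) <= -8.
  by case/orP => /charge_open; [move/(_ h2) | move/(_ h3)]; lra.
case: (degP M t) => [[d e hs]|[d e hs]|[d e hs]]; rewrite d /=;
  move: hs; rewrite (eqP h1) => hs.
- have := charge_le M (s t); have := charge_le M (si t).
  constructor 3; split; rewrite /S; try lra.
  by rewrite /weight /vertex_sum d /=; lra.
- case: (boolP (tri M (s (s t)))) => h5.
    have S4 : S = 4 by rewrite /S; move: hs; rewrite (eqP h5); lra.
    constructor 4; split=> //.
    have : ~~ rhomb M (s t) || ~~ rhomb M (si t).
      rewrite -negb_and; apply/negP => /andP[/rhomb_lt2 r1 /rhomb_lt2 r2].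
      by rewrite /S in S4; lra.
    move/hP => o4; rewrite /weight /vertex_sum d /= (charge_tri h5); split;
      first by lra.
    move=> /(charge_open h2) r1 /(charge_open h3) r2; lra.
  have o5 := charge_side h5; have g5 := side_gt1 h5.
  have [hS|hS|hS] := ltrgtP S 3.
  + constructor 1; split=> //; rewrite /weight /vertex_sum d /=; first by lra.
    by move/hP; lra.
  + constructor 3; rewrite /S in hS *; split=> //; first by lra.
    by rewrite /weight /vertex_sum d /=; lra.
  + constructor 2; split => //; rewrite /weight /vertex_sum d /=.
    have /(charge_open h5) : ~~ rhomb M (s (s t)).
      by apply/negP => /rhomb_lt2; rewrite /S in hS; lra.
    lra.
- have := angle_ge1 M (s (s t)); have := angle_ge1 M (si (si t)) => k1 k2.
  move: h4; rewrite /split5 d h1 /= => h4.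
  have hS : S < 3.
    rewrite /S; case/nandP: h4 => /side_gt1; lra.
  constructor 1; split=> //; rewrite /weight /vertex_sum d /=.
    case: (boolP (tri M (s (s t)))) h4 => [h5 /= h6|h5 _ /=].
      have := charge_tri h5; have := charge_side h6; lra.
    case: (boolP (tri M (si (si t)))) => [h6|h6].
      have := charge_tri h6; have := charge_side h5; lra.
    have := charge_side h6; have := charge_side h5; lra.
  move/hP => o4.
  case: (boolP (tri M (s (s t)))) h4 => [h5 /= h6|h5 _ /=].
    have := charge_tri h5; have := charge_side h6; lra.
  case: (boolP (tri M (si (si t)))) => [h6|h6].
    have := charge_tri h6; have := charge_side h5; lra.
  have := charge_side h6; have := charge_side h5; lra.
Qed.

Lemma tip_le0 t : tri M t -> ~~ tri M (s t) -> ~~ tri M (si t) -> ~~ split5 M t ->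
  share M t <= 0.
Proof.
move=> h1 h2 h3 h4; have := tipP h1 h2 h3 h4.
case=> [[_ + _]|[_]|[_ _]|[_ _ _ -> [h _]]]; try lra.
by rewrite mulr_ge0_le0 ?kappa_ge0 //; lra.
Qed.

Lemma share_split5 t : split5 M t -> share M t = payout M t.
Proof.
move=> h; have [h1 _ _ _ [h2 h3 _]] := split5P h.
by rewrite /share (negbTE h2) (negbTE h3) h.
Qed.

Lemma deg_split5 t : split5 M t -> deg M t = 5%N. Proof. by case/and4P => /eqP. Qed.

Lemma fan_le t : tri M t -> ~~ tri M (s t) -> ~~ tri M (si t) ->
  ~~ tri M (s (s t)) -> ~~ tri M (si (si t)) -> share M t <= -3.
Proof.
move=> h1 h2 h3 h4 h5.
have := charge_tri h1; have := charge_side h2; have := charge_side h3.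
have := charge_side h4; have := charge_side h5.
rewrite /share (negbTE h2) (negbTE h3) /split5 (negbTE h4) (negbTE h5) !andbF.
have := charge_le M (s t); have := charge_le M (si t).
rewrite /weight /vertex_sum.
case: (degP M t) => [[d e hs]|[d e hs]|[d e hs]]; rewrite d /=;
  move: hs; rewrite (eqP h1) => hs; lra.
Qed.

Lemma tipR_side l : si (tipR M l) = f (si l).
Proof. by rewrite /tipR -fnx_nxt prvK. Qed.

Lemma needR_tip l : needR M l ->
  [/\ deg M (tipR M l) = 4%N, tri M (s (s (tipR M l)))
    & s (s (tipR M l)) = si (si (tipR M l))].
Proof.
by case/and4P => /eqP h1 h2 _ _; split=> //; exact: deg4_opp.
Qed.

Lemma excessR_ge0 l : 0 <= excessR M l.
Proof.
rewrite /excessR; case: ifP => // _; have := kappa_le1 (tipR M l); lra.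
Qed.
Lemma excessR_le1 l : excessR M l <= 1.
Proof.
rewrite /excessR; case: ifP => _; have := kappa_ge0 (tipR M l); lra.
Qed.

Lemma needy_tipR l : rich M l -> needR M l -> needy M (tipR M l).
Proof.
move=> h1 h2; apply/orP; left; rewrite /needyR tipR_side fnxK prvK.
by rewrite h1 h2.
Qed.

(** The two other angles add up to 4, whereas an angle of a rhombus is below 2. *)
Lemma opp_tri_rhomb t : tri M t -> tri M (s (s t)) -> deg M t = 4%N ->
  rhomb M (s t) -> rhomb M (si t) -> False.
Proof.
move=> h1 h2 d /rhomb_lt2 r1 /rhomb_lt2 r2.
case: (degP M t) => [[]|[_ _ e]|[]]; [by rewrite d| |by rewrite d].
by move: e; rewrite (eqP h1) (eqP h2); lra.
Qed.

(** The contested case: the diamonds at both opposite corners of the tip want its weight. Only here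
    can the excess be nonzero. *)
Definition doubled l := [&& rich M l, needR M l & needy M (s (s (tipR M l)))].

Lemma excessR_doubled l : excessR M l != 0 -> doubled l.
Proof.
rewrite /excessR /doubled; case: ifP; last by rewrite eqxx.
case/andP => h1 h2; rewrite h1 h2 /= /kappa needy_tipR //.
by case: ifP => //; rewrite subrr eqxx.
Qed.

(** Only one of the two other corners at the tip is a rhombus, so both positive vertices are
    neighbours of the tip on this rhombus. At its fourth vertex, the end of [l], their isolated
    triangles lie on either side of the rhombus, and the rule of [kappa] can be read off from the
    next corners there. *)
Lemma doubledP l : doubled l ->
  [/\ rich M (si (f (f (si l)))), tri M (s (s (f l)))
    & excessR M l = if tri M (si (f l)) then (if tri M (s (s (s (f l)))) then
      2^-1 else 1)
                else if tri M (s (s (s (f l)))) then 0 else 2^-1].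
Proof.
case/and3P => h1 h2 h3.
have [d tt ee] := needR_tip h2.
set t := tipR M l in d tt ee h3 *.
have st : si t = f (si l) := tipR_side l.
have R0 := rich_rhomb' h1; have R1 := rhomb_fnx R0.
have Tt : tri M t.
  have [_ _ h4 _ _] := split5P (rich_split5 h1).
  by rewrite /t /tipR tri_fpv.
have NR : ~~ rhomb M (s t).
  apply/negP => r; apply: (@opp_tri_rhomb t) => //; by rewrite st.
have s3 : s (s (s t)) = si t by rewrite ee prvK.
have s3' : si (s (s t)) = s t by rewrite nxtK.
have Fz : rich M (si (f (f (si l)))).
  (* In one of the two orientations the second positive vertex would require a rhombus at [s t]. *)
  case/orP: h3 => /andP[].
    rewrite s3' => h4 _; move: (rich_rhomb' h4); rewrite nxtK => h5.
    by rewrite -(fpvK M (s t)) rhomb_fnx in NR.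
  by rewrite /= s3 st rich_mirror.
have g3 : f (f (f (si l))) = s (f l).
  have [_ _ _ eo] := rhomb_fpv R0; by rewrite -eo fpvK nxt_fnx.
split=> //.
  have [h4 _ _ _ _] := split5P (rich_split5 Fz).
  by move: h4; rewrite -tri_fpv fpv_prv g3.
rewrite /excessR h1 h2 /= -/t /kappa h3 needy_tipR //.
have -> : across M t = tri M (si (f l)).
  rewrite /across /acrossR rhomb_mirror /= (negbTE NR) orbF st R1 /= fnxK.
  by rewrite fpv_prv nxtK.
have -> : across M (s (s t)) = tri M (s (s (s (f l)))).
  rewrite /across /acrossR rhomb_mirror /= s3' (negbTE NR) /= s3 st R1 /=.
  by rewrite g3.
by case: ifP => _; case: ifP => _; field.
Qed.

End Tips.

(** * Bills inside an isolated triangle *)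

Section Single.
Context {R : realFieldType} {D : finType}.
Variable M : angle_map R D.
Notation s := (nxt M).
Notation si := (prv M).
Notation f := (fnx M).
Notation M' := (mirror M).

Lemma excessR_tri l : excessR M l != 0 -> tri M (s (s (f l))).
Proof. by move/excessR_doubled/doubledP => []. Qed.

(* The last conjunct says whether a triangle lies behind the outer side of the
   rhombus next to [l]. *)
Lemma claimRP l :
  [\/ claimR M l = 0,
      [/\ rich M l, split5 M (tipR M' l), claimR M l = 1 & ~~ tri M (s (s (f l)))]
    | [/\ rich M l, doubled M l, claimR M l = excessR M l & tri M (s (s (f l)))]].
Proof.
rewrite /claimR; case: (boolP (rich M l)) => hF; last by constructor 1.
case: ifP => hT.
  have h := tri_outer hF hT; constructor 2; split=> //.
  case: (eqVneq (excessR M l) 0) => [->|/excessR_tri]; first by rewrite addr0.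
  by rewrite (negbTE h).
rewrite add0r; case: (eqVneq (excessR M l) 0) => [->|he]; first by constructor 1.
by constructor 3; split=> //; [exact: excessR_doubled|exact: excessR_tri].
Qed.

Lemma rich_side_rhomb l : rich M l -> rhomb M (s (f l)).
Proof.
move/rich_rhomb' => h; rewrite nxt_fnx -rhomb_mirror; apply: (@rhomb_fnx _ _ M').
by rewrite rhomb_mirror.
Qed.

Lemma rich_side l : rich M l -> [/\ tri M l, ~~ tri M (s l) & ~~ tri M (si l)].
Proof. by move/rich_split5/split5P => [? _ _ _ [? ? _]]. Qed.

End Single.

Section SingleSplit.
Context {R : realFieldType} {D : finType}.
Variable M : angle_map R D.
Notation s := (nxt M).
Notation si := (prv M).
Notation f := (fnx M).
Notation fi := (fpv M).

(** A unit claim would need a corner [s (s c)] outside triangles. For an excess, only the competing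
    isolated triangle passes the test [across], and then the present diamond gets the whole
    weight. *)
Lemma single_split5 c : tri M c -> ~~ tri M (s c) -> ~~ tri M (si c) ->
  split5 M c -> claimR M (fi c) = 0.
Proof.
move=> h1 h2 h3 ht.
have [_ t2 t3 te _] := split5P ht.
case: (claimRP M (fi c)) => // [[_ _ _]|[_ hd -> _]]; first by rewrite fpvK t2.
by have [_ _ ->] := doubledP hd; rewrite fpvK (negbTE h3) te t3.
Qed.

Lemma needyR_diag t : needyR M t -> tri M (si (f t)).
Proof.
case/andP=> hF _; have [_ h _ e _] := split5P (rich_split5 hF).
have := tipR_opp M t; move: hF h e; set l := s (fi (si t)) => hF h e <-.
by rewrite /tipR fpvK -e nxtK.
Qed.

End SingleSplit.

Section SingleDoubled.
Context {R : realFieldType} {D : finType}.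
Variable M : angle_map R D.
Notation s := (nxt M).
Notation si := (prv M).
Notation f := (fnx M).
Notation fi := (fpv M).
Notation M' := (mirror M).

Lemma needy_diag t : needy M t -> tri M (si (f t)) || tri M (s (fi t)).
Proof.
case/orP => h; apply/orP; [left|right]; first exact: needyR_diag.
exact: (@needyR_diag _ _ M' t h).
Qed.

(** The corner [s (s c)] belongs to the isolated triangle of the second positive vertex. Its
    opposite side ends at that vertex and borders a rhombus there, so it is not the tip of a diamond
    and cannot be needy. *)
Lemma doubled_kappa c : tri M c -> deg M c = 4%N -> doubled M (fi c) ->
  2^-1 <= kappa M c.
Proof.
move=> hc d hd; have [hz h2 _] := doubledP hd.
have [z1 z2 z3] := rich_side hz.
rewrite /kappa; have -> : needy M (s (s c)) = false; last first.
  by case: ifP => _; lra.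
have [hF _ _] := and3P hd.
have [_ _ _ eo] := rhomb_fpv (rich_rhomb' hF).
have g3 : f (f (f (si (fi c)))) = s c.
  by rewrite -eo fpvK fpv_prv fpvK.
set z := si _ in hz z1 z2 z3.
have fz : fi z = s (s c) by rewrite /z fpv_prv g3.
apply/negP => /needy_diag; rewrite -fz fpvK (negbTE z3) /=.
by rewrite tri_fifi // nxt_fnx tri_fpv (negbTE z3).
Qed.

End SingleDoubled.

Section SingleTriangle.
Context {R : realFieldType} {D : finType}.
Variable M : angle_map R D.
Notation s := (nxt M).
Notation si := (prv M).
Notation f := (fnx M).
Notation fi := (fpv M).
Notation M' := (mirror M).

(** A unit and an excess never meet at one corner, by [path_split_tip]. Two excesses would force
    either the pattern of [split5] or two rhombi between opposite triangles. Two units leave no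
    other triangle within two corners of [c], and then [fan_le] suffices. *)
Lemma single_corner c : tri M c -> ~~ tri M (s c) -> ~~ tri M (si c) ->
  ~~ split5 M c -> share M c + claimR M (fi c) + claimR M' (f c) <= 0.
Proof.
move=> h1 h2 h3 ht.
have hle := tip_le0 h1 h2 h3 ht.
have x1 := excessR_ge0 M (fi c); have x2 := excessR_ge0 M' (f c).
have hT : forall l, rich M l -> doubled M l -> tri M (s (s (f l))) by
  move=> l _ /doubledP[].
have half : doubled M (fi c) -> excessR M (fi c) <= 2^-1.
  move=> hd; have [_ _ ->] := doubledP hd; rewrite fpvK (negbTE h3).
  by case: ifP; lra.
have half' : doubled M' (f c) -> excessR M' (f c) <= 2^-1.
  move=> hd; have [_ _ ->] := doubledP hd; rewrite /= fnxK.
  change (tri M' (s c)) with (tri M (s c)).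
  by rewrite (negbTE h2); case: ifP; lra.
have := tipP h1 h2 h3 ht.
have hS1 : rich M (fi c) -> rhomb M (s c).
  by move/rich_side_rhomb; rewrite fpvK.
have hS2 : rich M (f c) -> rhomb M (si c).
  by rewrite -rich_mirror => /rich_side_rhomb; rewrite rhomb_mirror /= fnxK.
case: (claimRP M (fi c)) => [->|[a1 a2 -> a4]|[a1 a2 -> a4]];
 case: (claimRP M' (f c)) => [->|[b1 b2 -> b4]|[b1 b2 -> b4]].
- lra.
- move: b4; rewrite /= fnxK => /negP b4.
  by case=> [[]|[]|[]|[_ /deg4_opp e]]; try lra; rewrite e => /b4.
- have := half' b2; move=> hb [[]|[]|[]|[_ d _ -> [hw _]]]; try lra.
  have := @doubled_kappa R D M' c h1 d b2; rewrite kappa_mirror.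
  nra.
- move: a4; rewrite /= fpvK => /negP a4.
  by case=> [[]|[]|[]|[_ _ /a4]]; try lra.
- move: a4 b4; rewrite /= fpvK fnxK => a4 b4 _.
  have := fan_le h1 h2 h3 a4 b4; lra.
- move=> _; exfalso; have := @path_split_tip _ _ M' (f c) b1 b4.
  by rewrite /= tri_ff // rich_mirror split5_mirror => /(_ a1)/(_ a2).
- have := half a2; move=> hb [[]|[]|[]|[_ d _ -> [hw _]]]; try lra.
  have : 2^-1 <= kappa M c by apply: doubled_kappa.
  nra.
- move=> _; exfalso; have := @path_split_tip _ _ M (fi c) a1 a4.
  rewrite tri_fifi // -rich_mirror => /(_ b1).
  by move: b2; rewrite /tipR /= split5_mirror.
- move=> _; exfalso; move: a4 b4; rewrite /= fpvK fnxK => a4 b4.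
  have r1 := hS1 a1; have r2 : rhomb M (si c) by apply: hS2; rewrite -rich_mirror.
  move: ht; rewrite /split5 h1.
  have b5 : tri M (si (si c)) by exact: b4.
  rewrite a4 b5 /=.
  case: (degP M c) => [[d e _]|[d e _]|[-> _ _]] //.
    by move: a4; rewrite e (negbTE h3).
  by move=> _; exact: (@opp_tri_rhomb _ _ M c).
Qed.

Definition lone c := [&& tri M c, ~~ tri M (s c) & ~~ tri M (si c)].

(** Each payout consists of the bills sent to the two other corners, so the bills cancel over the
    triangle. *)
Lemma single_le0 c : lone c -> lone (f c) -> lone (fi c) ->
  share M c + share M (f c) + share M (fi c) <= 0.
Proof.
have H x : lone x -> share M x + claimR M (fi x) + claimR M' (f x) <= payout M x.
  case/and3P => h1 h2 h3; case: (boolP (split5 M x)) => ht.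
    rewrite share_split5 // single_split5 // (@single_split5 _ _ M' x)
      ?split5_mirror //; lra.
  rewrite (payout_nrich (l := x)); first exact: single_corner.
  by apply: contra ht => /rich_split5.
move=> l1 l2 l3; have := H _ l1; have := H _ l2; have := H _ l3.
have Tc : tri M c by case/and3P: l1.
rewrite fnxK fpvK tri_ff // tri_fifi // /payout; lra.
Qed.

End SingleTriangle.

(** * Diamonds *)

Section DiamondFacts.
Context {R : realFieldType} {D : finType}.
Variable M : angle_map R D.
Notation s := (nxt M).
Notation si := (prv M).
Notation f := (fnx M).
Notation fi := (fpv M).
Notation M' := (mirror M).
Notation angle := (angle M).

Lemma rhomb_f c : rhomb M (f c) = rhomb M c.
Proof.
apply/idP/idP; last exact: rhomb_fnx.
by move=> /rhomb_fpv[]; rewrite fnxK.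
Qed.
Lemma rhomb_fi c : rhomb M (fi c) = rhomb M c.
Proof. by rewrite -{2}(fpvK M c) rhomb_f. Qed.
Lemma sideP' c : ~~ tri M c ->
  rhomb M c /\ angle (fi c) = 3 - angle c \/ ~~ rhomb M c /\
    3 < angle c + angle (fi c).
Proof.
by rewrite -(rhomb_mirror M) => h; exact: (@sideP _ _ M' c h).
Qed.

(* [m] and [si m] are two adjacent triangle corners at one vertex, [f m] and
   [s (f m)] the ones at the other end of the common side; [fi m] and [f (si m)]
   are the tips. *)
Definition diamond m := tri M m && tri M (si m).
Definition diamondsum m :=
  share M m + share M (si m) + share M (f m) + share M (s (f m))
  + share M (fi m) + share M (f (si m)).

Lemma diamond_rot m : diamond m -> diamond (s (f m)).
Proof.
by case/andP=> h1 h2; rewrite /diamond nxtK tri_fnx h1 nxt_fnx tri_fpv h2.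
Qed.
Lemma fi_rot m : tri M (si m) -> fi (s (f m)) = f (si m).
Proof. by move=> h; rewrite nxt_fnx tri_fifi. Qed.
Lemma f_rot m : f (s (f m)) = si m. Proof. exact: fsf. Qed.
Lemma diamondsum_rot m : diamond m -> diamondsum (s (f m)) = diamondsum m.
Proof.
case/andP=> h1 h2; rewrite /diamondsum f_rot prvK nxtK (fi_rot h2) tri_ff //; ring.
Qed.

Lemma lone_eq c : deg M c = 5%N -> s (s (s c)) = si (si c).
Proof. by case: (degP M c) => [[]|[]|[]] // ->. Qed.

Lemma diamond_pair m : diamond m ->
  share M m + share M (si m) = weight M m - payout M (s (s m)).
Proof.
case/andP=> h1 h2.
have h3 : tri M (s m) = false.
  by have := @tri_fan _ _ M (si m) h2; rewrite prvK => /(_ h1).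
have -> : payout M (s (s m)) = payout M (si (si (si m))).
  case: (boolP (deg M m == 5%N)) => [/eqP d|d].
    by rewrite -lone_eq ?prv_deg // prvK.
  rewrite !payout_nrich //; apply: contra d => /rich_deg5;
    rewrite ?deg_nxt ?prv_deg => -> //.
rewrite /share h3 h2 prvK h1 weight_prv.
have -> : payout M (s (s m)) = payout M (si (si (si m))).
  case: (boolP (deg M m == 5%N)) => [/eqP d|d].
    by rewrite -lone_eq ?prv_deg // prvK.
  rewrite !payout_nrich //; apply: contra d => /rich_deg5;
    rewrite ?deg_nxt ?prv_deg => -> //.
lra.
Qed.

Lemma diamondsumE m : diamond m -> diamondsum m =
  (weight M m - payout M (s (s m))) + (weight M (f m) - payout M (s (s (s (f m)))))
  + share M (fi m) + share M (f (si m)).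
Proof.
move=> h; rewrite -diamond_pair //; have := diamond_pair (diamond_rot h).
by rewrite nxtK weight_nxt /diamondsum => <-; ring.
Qed.

Lemma diamond_side m : diamond m -> ~~ tri M (s m) /\ ~~ tri M (si (si m)).
Proof.
case/andP=> h1 h2; split; apply/negP => h3.
  by have := @tri_fan _ _ M (si m) h2; rewrite prvK h3 => /(_ h1).
by have := @tri_back _ _ M (si m) h2; rewrite prvK h3 => /(_ h1).
Qed.

(** The constants 8 and 7 are 5 plus the number of triangles at the vertex. *)
Lemma apexP m : diamond m ->
  [\/ [/\ split5 M (s (s m)), angle (s m) + angle (si (si m)) = 3
         & weight M m = 8 + charge M (s m) + charge M (si (si m))],
      ~~ split5 M (s (s m)) /\ weight M m <= -2
    | [/\ ~~ split5 M (s (s m)), angle (s m) + angle (si (si m)) = 4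
         & weight M m = 7 + charge M (s m) + charge M (si (si m))]].
Proof.
move=> hd; have [h3 h4] := diamond_side hd; case/andP: hd => h1 h2.
have o1 := charge_tri h1; have o2 := charge_tri h2; have o3 := charge_side h3;
  have o4 := charge_side h4.
have g3 := side_gt1 h3; have g4 := side_gt1 h4.
rewrite /weight /vertex_sum o1 o2; have := charge_le M (s m).
case: (degP M m) => [[d e hs]|[d e hs]|[d e hs]]; rewrite d /=;
  move: hs; rewrite (eqP h1) (eqP h2) => hs hm.
- constructor 2; split; last by lra.
  by apply/negP => /deg_split5; rewrite !deg_nxt d.
- constructor 3; split; last by rewrite e; lra.
    by apply/negP => /deg_split5; rewrite !deg_nxt d.
  by rewrite -e; lra.
- have e5 : s (s (s (s m))) = si m by rewrite e prvK.
  case: (boolP (tri M (s (s m)))) => h5.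
    constructor 1; split.
    + by rewrite /split5 !deg_nxt d h5 !nxtK h1 e5 h2.
    + by move: hs; rewrite (eqP h5); lra.
    + by rewrite (charge_tri h5); lra.
  constructor 2; split; first by rewrite /split5 (negbTE h5) !andbF.
  have := charge_side h5; lra.
Qed.

Lemma diamond_lone m : diamond m -> split5 M (s (s m)) ->
  [/\ si (s (s m)) = s m, s (s (s m)) = si (si m), tipR M (s (s m)) = fi m
    & tipR M' (s (s m)) = f (si m)].
Proof.
move=> h /deg_split5; rewrite !deg_nxt => /lone_eq e.
by rewrite /tipR !nxtK /= e prvK.
Qed.

Lemma diamond_rich m : diamond m ->
  rich M (s (s m)) = [&& split5 M (s (s m)), rhomb M (s m) & rhomb M (si (si m))].
Proof.
move=> h; rewrite /rich; case: (boolP (split5 M _)) => //= h3.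
have [-> -> _ _] := diamond_lone h h3; by rewrite andbC.
Qed.

Lemma diamond_lefttip m : diamond m -> [/\ tri M (fi m), ~~ tri M (s (fi m)),
  ~~ tri M (si (fi m)), si (fi m) = f (s m) & s (fi m) = fi (si (f m))].
Proof.
move=> h; have [h3 h4] := diamond_side h;
  have [h5 h6] := diamond_side (diamond_rot h).
case/andP: h => h1 h2.
have e1 : si (fi m) = f (s m) by rewrite fnx_nxt.
have e2 : s (fi m) = fi (si (f m)) by rewrite fpv_prv tri_ff.
rewrite tri_fpv h1 e1 tri_fnx h3 e2 tri_fpv; split=> //.
by rewrite nxtK in h6.
Qed.

Lemma diamond_righttip m : diamond m -> [/\ tri M (f (si m)), ~~ tri M (s (f (si m))),
  ~~ tri M (si (f (si m))), s (f (si m)) = fi (si (si m))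
  & si (f (si m)) = f (s (s (f m)))].
Proof.
move=> h; have [h3 h4] := diamond_side h;
  have [h5 h6] := diamond_side (diamond_rot h).
case/andP: h => h1 h2.
have e1 : s (f (si m)) = fi (si (si m)) by rewrite nxt_fnx.
have e2 : si (f (si m)) = f (s (s (f m))) by rewrite -fi_rot // -fnx_nxt.
by rewrite tri_fnx h2 e1 tri_fpv h4 e2 tri_fnx h5.
Qed.

End DiamondFacts.

Section DiamondMirror.
Context {R : realFieldType} {D : finType}.
Variable M : angle_map R D.
Notation s := (nxt M).
Notation si := (prv M).
Notation f := (fnx M).
Notation fi := (fpv M).
Notation M' := (mirror M).

Lemma diamond_mirror m : diamond M m -> diamond M' (si m).
Proof.
case/andP=> h1 h2; rewrite /diamond /= prvK.
change (tri M (si m) && tri M m); by rewrite h2 h1.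
Qed.

Lemma diamondsum_mirror m : diamond M m -> diamondsum M' (si m) = diamondsum M m.
Proof.
move=> h; have [h3 _ _ _ _] := diamond_lefttip h;
  have [h4 _ _ _ _] := diamond_righttip h.
have h5 := diamond_rot h; case/andP: (h) => h1 h2.
case/andP: h5; rewrite nxtK => h5 h6.
rewrite /diamondsum /= prvK.
have e1 : fi (si m) = s (f m) by rewrite nxt_fnx.
rewrite e1 nxtK !share_mirror //.
ring.
Qed.

End DiamondMirror.

(** * Diamonds with uncontested tips *)

Section DiamondCases.
Context {R : realFieldType} {D : finType}.
Variable M : angle_map R D.
Notation s := (nxt M).
Notation si := (prv M).
Notation f := (fnx M).
Notation fi := (fpv M).
Notation M' := (mirror M).
Notation angle := (angle M).

Definition b2r (b : bool) : R := if b then 1 else 0.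

Lemma payout_ge l : rich M l ->
  b2r (split5 M (tipR M' l)) + b2r (split5 M (tipR M l)) + excessR M l <= payout M l.
Proof.
move=> h; rewrite /payout /claimR rich_mirror h /b2r split5_mirror.
have := excessR_ge0 M l; have := excessR_ge0 M' l.
change (tipR (mirror M') l) with (tipR M l); lra.
Qed.

Lemma payout_nsplit5 l : ~~ split5 M l -> payout M l = 0.
Proof. by move=> h; apply: payout_nrich; apply: contra h => /rich_split5. Qed.

Lemma diamond_payout m : diamond M m -> rich M (s (s m)) ->
  b2r (split5 M (fi m)) + b2r (split5 M (f (si m))) + excessR M (s (s m))
    <= payout M (s (s m)).
Proof.
move=> h hF; have [_ _ <- <-] := diamond_lone h (rich_split5 hF).
have := payout_ge hF; lra.
Qed.

Lemma lone_rot m : diamond M m -> split5 M (s (s (s (f m)))) ->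
  si (si (f m)) = s (s (s (f m))).
Proof.
move=> h /deg_split5; rewrite !deg_nxt => /lone_eq <- //.
Qed.

Definition quiet t := excessR M t = 0 /\ excessR M' t = 0.

(** Only a tip with the pattern of [split5] can have a positive share. Without excess its claims are
    units, and each unit forbids a triangle at the place where one apex would have its isolated
    triangle. *)
Lemma lefttip_le m : diamond M m -> quiet (fi m) ->
  share M (fi m) <= b2r (rich M (fi m) && ~~ split5 M (s (s m)))
               + b2r (rich M (fi m) && ~~ split5 M (s (s (s (f m))))).
Proof.
move=> h [q1 q2]; have [h1 h2 h3 _ _] := diamond_lefttip h.
case: (boolP (split5 M (fi m))) => hT; last first.
  have := tip_le0 h1 h2 h3 hT; rewrite /b2r; do ! case: ifP => _; lra.
rewrite share_split5 // /payout; apply: lerD.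
  case: (claimRP M (fi m)) => [->|[hF _ -> h4]|[_ _ -> _]].
  - by rewrite /b2r; case: ifP.
  - rewrite hF; move: h4; rewrite fpvK => h4.
    by rewrite /split5 (negbTE h4) !andbF.
  - by rewrite q1 /b2r; case: ifP.
case: (claimRP M' (fi m)) => [->|[hF _ -> h4]|[_ _ -> _]].
- by rewrite /b2r; case: ifP.
- rewrite -rich_mirror hF /=.
  have h5 : ~~ tri M (si (si (f m))).
    by move: h4; rewrite /= tri_fifi //; case/andP: h.
  have -> // : ~~ split5 M (s (s (s (f m)))).
  apply/negP => ht; move: (h5); rewrite (lone_rot h ht).
  by case/split5P: ht => ->.
- by rewrite q2 /b2r; case: ifP.
Qed.

Lemma righttip_le m : diamond M m -> quiet (f (si m)) ->
  share M (f (si m)) <= b2r (rich M (f (si m)) && ~~ split5 M (s (s m)))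
               + b2r (rich M (f (si m)) && ~~ split5 M (s (s (s (f m))))).
Proof.
move=> h; have h' := diamond_rot h; case/andP: (h) => h1 h2 q.
have := @lefttip_le _ h'; rewrite (fi_rot h2) f_rot prvK => /(_ q); lra.
Qed.

Lemma b2r_le1 b : 0 <= b2r b <= 1.
Proof. by rewrite /b2r; case: b; rewrite lexx ler01. Qed.

Lemma weight_split5 m : diamond M m -> split5 M (s (s m)) ->
  weight M m = 8 + charge M (s m) + charge M (si (si m)).
Proof.
by move=> h ht; case: (apexP h) => [[]|[/negP]|[/negP]].
Qed.

Lemma diamond_sides m : diamond M m ->
  [/\ rhomb M (s m) /\ angle (si (fi m)) = 3 - angle (s m) \/
      ~~ rhomb M (s m) /\ 3 < angle (s m) + angle (si (fi m)),
      rhomb M (si (si m)) /\ angle (s (f (si m))) = 3 - angle (si (si m)) \/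
      ~~ rhomb M (si (si m)) /\ 3 < angle (si (si m)) + angle (s (f (si m))),
      rhomb M (si (f m)) /\ angle (s (fi m)) = 3 - angle (si (f m)) \/
      ~~ rhomb M (si (f m)) /\ 3 < angle (si (f m)) + angle (s (fi m))
    & rhomb M (s (s (f m))) /\ angle (si (f (si m))) = 3 - angle (s (s (f m))) \/
      ~~ rhomb M (s (s (f m))) /\ 3 < angle (s (s (f m))) + angle (si (f (si m)))].
Proof.
move=> h; have [h3 h4] := diamond_side h;
  have [h5 h6] := diamond_side (diamond_rot h).
rewrite nxtK in h6.
have [_ _ _ -> ->] := diamond_lefttip h; have [_ _ _ -> ->] := diamond_righttip h.
by split; [exact: sideP|exact: sideP'|exact: sideP'|exact: sideP].
Qed.

Lemma diamond_rhombE m : diamond M m ->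
  [/\ rhomb M (si (fi m)) = rhomb M (s m),
    rhomb M (s (f (si m))) = rhomb M (si (si m)),
      rhomb M (s (fi m)) = rhomb M (si (f m))
    & rhomb M (si (f (si m))) = rhomb M (s (s (f m)))].
Proof.
move=> h; have [_ _ _ -> ->] := diamond_lefttip h;
  have [_ _ _ -> ->] := diamond_righttip h.
by rewrite !rhomb_f !rhomb_fi.
Qed.

(** If both tips are positive, all four outer sides border rhombi; then no apex has side angles with
    sum 4, and both weights are at most -2. *)
Lemma diamond_nsplit5_nsplit5 m : diamond M m -> quiet (fi m) -> quiet (f (si m)) ->
  ~~ split5 M (s (s m)) -> ~~ split5 M (s (s (s (f m)))) -> diamondsum M m <= 0.
Proof.
move=> h q1 q2 hA hB; rewrite diamondsumE //.
have := lefttip_le h q1; have := righttip_le h q2; rewrite hA hB !andbT.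
rewrite (payout_nsplit5 hA) (payout_nsplit5 hB).
have [N1 N2] := diamond_side h; have [N3 N4] := diamond_side (diamond_rot h).
have O1 := charge_side N1; have O2 := charge_side N2; have O3 := charge_side N3;
  have O4 := charge_side N4.
have [r1 r2 r3 r4] := diamond_rhombE h.
have wa : weight M m <= -2 \/ angle (s m) + angle (si (si m)) = 4 /\ weight M m <= -1.
  case: (apexP h) => [[ht]|[_]|[_ e ->]]; first by rewrite ht in hA.
    by move=> hw; left.
  right; split=> //.
  case: (boolP (rhomb M (s m))) => [/rhomb_lt2 k1|/(charge_open N1)]; last by lra.
  case: (boolP (rhomb M (si (si m)))) => [/rhomb_lt2 k2|/(charge_open N2)];
    last by lra.
  lra.
have wb : weight M (f m) <= -2 \/
    angle (s (s (f m))) + angle (si (f m)) = 4 /\ weight M (f m) <= -1.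
  rewrite -weight_nxt.
  case: (apexP (diamond_rot h)) => [[ht]|[_]|[_]]; first by rewrite ht in hB.
    by move=> hw; left.
  move: N4 O4; rewrite nxtK => N4 O4 e ->; right; split=> //.
  case: (boolP (rhomb M (s (s (f m))))) => [/rhomb_lt2 k1|/(charge_open N3)];
    last by lra.
  case: (boolP (rhomb M (si (f m)))) => [/rhomb_lt2 k2|/(charge_open N4)];
    last by lra.
  lra.
case: (boolP (rich M (fi m))) => f1; case: (boolP (rich M (f (si m)))) => f2;
  rewrite /b2r.
- have := rich_rhomb f1; have := rich_rhomb' f1; have := rich_rhomb f2;
    have := rich_rhomb' f2.
  rewrite r1 r2 r3 r4 => /rhomb_lt2 k1 /rhomb_lt2 k2 /rhomb_lt2 k3 /rhomb_lt2 k4.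
  case: wa => [wa|[]]; case: wb => [wb|[]]; lra.
- case: wa => [wa|[]]; case: wb => [wb|[]]; lra.
- case: wa => [wa|[]]; case: wb => [wb|[]]; lra.
- case: wa => [wa|[]]; case: wb => [wb|[]]; lra.
Qed.

Lemma weight_split5_le0 m : diamond M m -> split5 M (s (s m)) ->
  weight M m <= 2 /\ (~~ rich M (s (s m)) -> weight M m <= 0).
Proof.
move=> h ht; rewrite weight_split5 // diamond_rich // ht /=.
have [N1 N2] := diamond_side h; have O1 := charge_side N1; have O2 := charge_side N2.
split; first lra.
by case/nandP => [/(charge_open N1)|/(charge_open N2)]; lra.
Qed.

Lemma diamond_nrich_nrich m : diamond M m -> quiet (fi m) -> quiet (f (si m)) ->
  split5 M (s (s m)) -> split5 M (s (s (s (f m)))) ->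
  ~~ rich M (s (s m)) -> ~~ rich M (s (s (s (f m)))) -> diamondsum M m <= 0.
Proof.
move=> h q1 q2 hA hB fA fB; rewrite diamondsumE //.
have := lefttip_le h q1; have := righttip_le h q2; rewrite hA hB !andbF /b2r.
rewrite (payout_nrich fA) (payout_nrich fB).
have [_ /(_ fA)] := weight_split5_le0 h hA.
have [_ /(_ fB)] := weight_split5_le0 (diamond_rot h) hB; rewrite weight_nxt; lra.
Qed.

Lemma diamond_nrich_nsplit5 m : diamond M m -> quiet (fi m) -> quiet (f (si m)) ->
  split5 M (s (s m)) -> ~~ split5 M (s (s (s (f m)))) ->
  ~~ rich M (s (s m)) -> diamondsum M m <= 0.
Proof.
move=> h q1 q2 hA hB fA; rewrite diamondsumE //.
have := lefttip_le h q1; have := righttip_le h q2; rewrite hA hB !andbF !andbT /=.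
rewrite (payout_nrich fA) (payout_nsplit5 hB).
have [_ /(_ fA)] := weight_split5_le0 h hA.
have [r1 r2 r3 r4] := diamond_rhombE h.
have : b2r (rich M (fi m)) + b2r (rich M (f (si m))) <= 1.
  move: fA; rewrite diamond_rich // hA /= => fA.
  rewrite /b2r; case: ifP => [/rich_rhomb'|_]; case: ifP => [/rich_rhomb|_]; try lra.
  by rewrite r1 r2 => k1 k2; rewrite k1 k2 in fA.
have [N3 N4] := diamond_side (diamond_rot h).
have wb : weight M (f m) <= -1.
  rewrite -weight_nxt.
  case: (apexP (diamond_rot h)) => [[ht]|[_]|[_]]; first by rewrite ht in hB.
    by lra.
  have O3 := charge_side N3; have O4 := charge_side N4 => e ->.
  case: (boolP (rhomb M (s (s (f m))))) => [/rhomb_lt2 k1|/(charge_open N3)];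
    last by lra.
  case: (boolP (rhomb M (si (si (s (f m)))))) => [/rhomb_lt2 k2|/(charge_open
    N4)]; last by lra.
  lra.
rewrite /b2r; lra.
Qed.

Lemma b2rT (b : bool) : b -> b2r b = 1. Proof. by move->. Qed.
Lemma b2rF (b : bool) : ~~ b -> b2r b = 0. Proof. by move/negbTE->. Qed.

(** The side angles add up to 3 at each apex and to 3 across each rhombus side, so the side sums at
    the two tips add up to 6. Hence either both are 3, or one is below and one above 3, and the
    bounds -1 and -3 of [tipP] pay for 2 + 2. *)
Lemma diamond_rich_rich m : diamond M m -> quiet (fi m) -> quiet (f (si m)) ->
  rich M (s (s m)) -> rich M (s (s (s (f m)))) -> diamondsum M m <= 0.
Proof.
move=> h q1 q2 fA fB; rewrite diamondsumE //.
have hA := rich_split5 fA; have hB := rich_split5 fB; have h' := diamond_rot h.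
have := lefttip_le h q1; have := righttip_le h q2; rewrite hA hB !andbF.
have := diamond_payout h fA; have := diamond_payout h' fB; rewrite nxtK.
have [m1 m2] := andP h; rewrite (fi_rot m2) (tri_ff m1).
have := excessR_ge0 M (s (s m)); have := excessR_ge0 M (s (s (s (f m)))).
have [wa _] := weight_split5_le0 h hA; have [wb _] := weight_split5_le0 h' hB;
  rewrite weight_nxt in wb.
have [s1 s2 s3 s4] := diamond_sides h.
have [r1 r2 r3 r4] := diamond_rhombE h.
have [y1 y2 y3 _ _] := diamond_lefttip h; have [x1 x2 x3 _ _] := diamond_righttip h.
have g1 := side_gt1 y2; have g2 := side_gt1 y3; have g3 := side_gt1 x2;
  have g4 := side_gt1 x3.
have [_ _ _ _ [_ _ ea]] := split5P hA; have [_ _ _ _ [_ _ eb]] := split5P hB.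
have [la1 la2 _ _] := diamond_lone h hA; have [lb1 lb2 _ _] := diamond_lone h' hB.
rewrite la1 la2 in ea; rewrite lb1 lb2 nxtK in eb.
move: (fA); rewrite diamond_rich // hA /= => /andP[k1 k2].
move: (fB); rewrite diamond_rich // hB /= nxtK => /andP[k4 k3].
rewrite k1 k2 k3 k4 /= in s1 s2 s3 s4.
case: s1 => [[_ s1]|[]//]; case: s2 => [[_ s2]|[]//].
case: s3 => [[_ s3]|[]//]; case: s4 => [[_ s4]|[]//].
case: (boolP (split5 M (fi m))) => ty; case: (boolP (split5 M (f (si m)))) => tx;
  rewrite /b2r /=.
- lra.
- have [_ _ _ _ [_ _ ey]] := split5P ty.
  case: (tipP x1 x2 x3 tx) => [[]|[]|[]|[]];
    clear -wa wb ea eb s1 s2 s3 s4 g1 g2 g3 g4 ey; lra.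
- have [_ _ _ _ [_ _ ey]] := split5P tx.
  case: (tipP y1 y2 y3 ty) => [[]|[]|[]|[]];
    clear -wa wb ea eb s1 s2 s3 s4 g1 g2 g3 g4 ey; lra.
- case: (tipP x1 x2 x3 tx) => [[]|[]|[]|[]];
  case: (tipP y1 y2 y3 ty) => [[]|[]|[]|[]];
    clear -wa wb ea eb s1 s2 s3 s4 g1 g2 g3 g4; lra.
Qed.

End DiamondCases.

(** * Diamonds with an open outer side at the second apex *)

Section DiamondOpen.
Context {R : realFieldType} {D : finType}.
Variable M : angle_map R D.
Notation s := (nxt M).
Notation si := (prv M).
Notation f := (fnx M).
Notation fi := (fpv M).
Notation angle := (angle M).

Lemma diamond_payout_needR m : diamond M m -> rich M (s (s m)) ->
  split5 M (s (s (s (f m)))) ->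
  rhomb M (s (s (f m))) -> deg M (fi m) = 4%N -> tri M (s (s (fi m))) ->
  needR M (s (s m)).
Proof.
move=> h hF hB hq d hT.
have [_ _ e _] := diamond_lone h (rich_split5 hF).
rewrite /needR e d hT /= !nxtK hq (lone_rot h hB) hB //.
Qed.

(** The open side pushes the total of the side sums at the tips above 6, so at most one tip has the
    pattern of [split5]. In the tight case the left tip has degree 4, and its fraction of the weight
    and the excess together provide the missing unit. *)
Lemma diamond_rich_split5 m : diamond M m -> quiet M (fi m) -> quiet M (f (si m)) ->
  rich M (s (s m)) -> split5 M (s (s (s (f m)))) -> ~~ rhomb M (si (f m)) ->
  diamondsum M m <= 0.
Proof.
move=> h q1 q2 fA hB nq; rewrite diamondsumE //.
have hA := rich_split5 fA; have h' := diamond_rot h.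
have [N3 N4] := diamond_side h'; have wb := weight_split5 h' hB.
rewrite nxtK weight_nxt in wb N4.
have fB : ~~ rich M (s (s (s (f m)))).
  by rewrite diamond_rich // nxtK (negbTE nq) !andbF.
have := lefttip_le h q1; have := righttip_le h q2;
  rewrite hA hB !andbF (payout_nrich fB).
have := diamond_payout h fA; have e0 := excessR_ge0 M (s (s m)).
have [wa _] := weight_split5_le0 h hA.
have O4 := charge_open N4 nq.
move=> ho; rewrite {1 2 3 4}/b2r /= => ht1 ht2.
case: (boolP (rhomb M (s (s (f m))))) => hq2; last first.
  have := charge_open N3 hq2; have := @b2r_le1 R (split5 M (fi m)).
  have := @b2r_le1 R (split5 M (f (si m))); clear -wa wb ho ht1 ht2 e0 O4.
  lra.
have O3 := charge_rhomb hq2.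
have [s1 s2 s3 s4] := diamond_sides h.
have [y1 y2 y3 _ _] := diamond_lefttip h; have [x1 x2 x3 _ _] := diamond_righttip h.
have g1 := side_gt1 y2; have g2 := side_gt1 y3; have g3 := side_gt1 x2;
  have g4 := side_gt1 x3.
have [_ _ _ _ [_ _ ea]] := split5P hA; have [_ _ _ _ [_ _ eb]] := split5P hB.
have [la1 la2 la3 _] := diamond_lone h hA; have [lb1 lb2 _ _] := diamond_lone h' hB.
rewrite la1 la2 in ea; rewrite lb1 lb2 nxtK in eb.
move: (fA); rewrite diamond_rich // hA /= => /andP[k1 k2].
rewrite k1 k2 (negbTE nq) hq2 /= in s1 s2 s3 s4.
case: s1 => [[_ s1]|[]//]; case: s2 => [[_ s2]|[]//].
case: s3 => [[]//|[_ s3]]; case: s4 => [[_ s4]|[]//].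
have wy : forall d : deg M (fi m) = 4%N, tri M (s (s (fi m))) ->
    excessR M (s (s m)) = 1 - kappa M (fi m).
  move=> d hT; rewrite /excessR fA (diamond_payout_needR h fA hB hq2 d hT) /= la3 //.
(* A unit for the right tip excludes an excess at the left one, so in that case [kappa] must be
   1. *)
have hT3 : split5 M (f (si m)) -> excessR M (s (s m)) = 0.
  move=> ht; apply/eqP; apply/negP => /negP /excessR_tri; apply/negP.
  by apply: tri_outer => //; have [_ _ _ ->] := diamond_lone h hA.
have nty : split5 M (f (si m)) -> ~~ split5 M (fi m).
  move=> tx; apply/negP => ty.
  have [_ _ _ _ [_ _ ex]] := split5P tx; have [_ _ _ _ [_ _ ey]] := split5P ty.
  clear -ea eb s1 s2 s3 s4 ex ey; lra.
have k0 := kappa_ge0 M (fi m).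
have b1 := @b2r_le1 R (split5 M (fi m)).
case: (boolP (split5 M (f (si m)))) ho => tx; rewrite /b2r /= => ho.
  have ty := nty tx; rewrite (negbTE ty) in ho.
  have [_ _ _ _ [_ _ ex]] := split5P tx.
  case: (tipP y1 y2 y3 ty) => [[]|[]|[]|[_ d hT -> [hw _]]].
  - clear -ea eb s1 s2 s3 s4 ex; lra.
  - clear -ea eb s1 s2 s3 s4 ex; lra.
  - clear -wa wb ho ht1 O3 O4 e0; lra.
  have e1 := wy d hT; have e2 := hT3 tx.
  have ek : kappa M (fi m) = 1 by lra.
  rewrite ek; clear -wa wb ho ht1 O3 O4 e0 hw; lra.
have ho' : excessR M (s (s m)) <= payout M (s (s m)).
  by move: ho; case: ifP => _; clear; lra.
case: (tipP x1 x2 x3 tx) => [[hS hx _]|[hS hx]|[hS _ hx]|[hS _ _ _ _]].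
- have ty : ~~ split5 M (fi m).
    apply/negP => ty; have [_ _ _ _ [_ _ ey]] := split5P ty.
    clear -ea eb s1 s2 s3 s4 hS ey; lra.
  case: (tipP y1 y2 y3 ty) => [[]|[]|[]|[_ d hT -> [hw _]]].
  + clear -ea eb s1 s2 s3 s4 hS; lra.
  + clear -ea eb s1 s2 s3 s4 hS; lra.
  + clear -wa wb ho' e0 hx O3 O4; lra.
  have e1 := wy d hT.
  have : kappa M (fi m) * weight M (fi m) <= - kappa M (fi m) by clear -hw k0; nra.
  clear -wa wb ho' e0 hx O3 O4 e1; lra.
- clear -wa wb ho' e0 hx O3 O4 ht2; lra.
- clear -wa wb ho' e0 hx O3 O4 ht2; lra.
- have := rhomb_lt2 k1; have := rhomb_lt2 k2; have := rhomb_gt1 k2;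
    have := rhomb_gt1 hq2.
  clear -s2 s4 hS; lra.
Qed.

Lemma diamond_rich_nsplit5_aux m : diamond M m -> quiet M (fi m) ->
  quiet M (f (si m)) ->
  rich M (s (s m)) -> ~~ split5 M (s (s (s (f m)))) -> ~~ rhomb M (si (f m)) ->
  angle (s (s (f m))) + angle (si (f m)) = 4 ->
  weight M (f m) = 7 + charge M (s (s (f m))) + charge M (si (f m)) ->
  diamondsum M m <= 0.
Proof.
move=> h q1 q2 fA hB nq e4 wb; rewrite diamondsumE //.
have hA := rich_split5 fA; have h' := diamond_rot h.
have [N3 N4] := diamond_side h'; rewrite nxtK in N4.
have := lefttip_le h q1; have := righttip_le h q2;
  rewrite hA hB !andbF !andbT (payout_nsplit5 hB).
have := diamond_payout h fA; have e0 := excessR_ge0 M (s (s m)).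
have [wa _] := weight_split5_le0 h hA.
have O4 := charge_open N4 nq; have O3 := charge_side N3.
have [y1 y2 y3 _ _] := diamond_lefttip h; have [x1 x2 x3 _ _] := diamond_righttip h.
have [r1 r2 r3 r4] := diamond_rhombE h.
have nFy : rich M (fi m) = false.
  by apply/negP => /rich_rhomb; rewrite r3 (negbTE nq).
rewrite nFy /= => ho htx hty.
have {}hty : share M (fi m) <= 0 by move: hty; rewrite /b2r; clear; lra.
have {}htx : share M (f (si m)) <= b2r (split5 M (f (si m))).
  case: (boolP (split5 M (f (si m)))) => tx.
    by move: htx (@b2r_le1 R (rich M (f (si m)))); rewrite /b2r /=; clear; lra.
  by rewrite /b2r; exact: tip_le0.
case: (boolP (rhomb M (s (s (f m))))) => hq2; last first.
  have := charge_open N3 hq2; have := @b2r_le1 R (split5 M (fi m)).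
  clear -wa wb ho htx hty e0 O4; lra.
have [s1 s2 s3 s4] := diamond_sides h.
have g1 := side_gt1 y2; have g2 := side_gt1 y3; have g3 := side_gt1 x2;
  have g4 := side_gt1 x3.
have [_ _ _ _ [_ _ ea]] := split5P hA.
have [la1 la2 la3 _] := diamond_lone h hA.
rewrite la1 la2 in ea.
move: (fA); rewrite diamond_rich // hA /= => /andP[k1 k2].
rewrite k1 k2 (negbTE nq) hq2 /= in s1 s2 s3 s4.
case: s1 => [[_ s1]|[]//]; case: s2 => [[_ s2]|[]//].
case: s3 => [[]//|[_ s3]]; case: s4 => [[_ s4]|[]//].
have l2 := rhomb_lt2 k2; have l1 := rhomb_lt2 k1; have l3 := rhomb_gt1 k2;
  have l4 := rhomb_gt1 hq2.
have l5 := rhomb_lt2 hq2.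
case: (boolP (split5 M (fi m))) => ty.
  rewrite (@b2rT R _ ty) in ho; clear -wa wb ho htx hty e0 O4 O3; lra.
rewrite (@b2rF R _ ty) in ho.
case: (boolP (split5 M (f (si m)))) => tx; last first.
  rewrite (@b2rF R _ tx) in ho htx.
  case: (tipP x1 x2 x3 tx) => [[hS hx _]|[hS hx]|[hS _ hx]|[hS _ _ _ _]];
    try by clear -wa wb ho htx hty e0 O4 O3 hx; lra.
  clear -s2 s4 hS l3 l4; lra.
rewrite (@b2rT R _ tx) in ho htx.
have [_ _ _ _ [_ _ ex]] := split5P tx.
case: (tipP y1 y2 y3 ty) => [[hS hx _]|[hS hx]|[hS _ hx]|[hS _ _ _ _]];
  try by clear -wa wb ho htx e0 O4 O3 hx; lra.
(* Left is the case of side sum 4 at the left tip. With a the angle at [s m], the open angle is 4 -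
   a and the angle facing it 1 + a, so this bound, where the third angle is estimated by 1, is 2 a -
   11 < -7. *)
have hom : charge M (si (f m)) <= 7 - 4 * angle (si (f m)) - 2 * angle (s (fi m)).
  have [_ _ _ _ ->] := diamond_lefttip h.
  rewrite /charge; have := angle_ge1 M (f (si (f m))); clear; lra.
clear y1 y2 y3 x1 x2 x3 r1 r2 r3 r4.
clear -wa wb ho htx hty e0 O3 hom hS ex ea s1 s2 s4 e4 l1; lra.
Qed.

End DiamondOpen.

Section DiamondSymmetry.
Context {R : realFieldType} {D : finType}.
Variable M : angle_map R D.
Notation s := (nxt M).
Notation si := (prv M).
Notation f := (fnx M).
Notation fi := (fpv M).
Notation M' := (mirror M).
Notation angle := (angle M).

Lemma quiet_mirror t : quiet M' t <-> quiet M t.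
Proof. by split=> -[? ?]; split. Qed.

Lemma diamond_lone_mirror m : diamond M m ->
  rich M (si (si (si m))) = rich M (s (s m)) /\
  split5 M (si (si (si m))) = split5 M (s (s m)).
Proof.
move=> h; case: (boolP (deg M m == 5%N)) => [/eqP d|d].
  by rewrite -lone_eq ?prv_deg // prvK.
have n1 : ~~ split5 M (s (s m)).
  by apply: contra d => /deg_split5; rewrite !deg_nxt => ->.
have n2 : ~~ split5 M (si (si (si m))).
  by apply: contra d => /deg_split5; rewrite !prv_deg => ->.
by rewrite /rich (negbTE n1) (negbTE n2).
Qed.

Lemma diamond_split5 m : diamond M m -> rhomb M (s m) -> tri M (s (s m)) ->
  split5 M (s (s m)).
Proof.
move=> h /rhomb_lt2 r hT; have [N1 N2] := diamond_side h; have [m1 m2] := andP h.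
case: (degP M m) => [[d e hs]|[d e hs]|[d e hs]].
- by move: hs r; rewrite (eqP m1) (eqP m2); lra.
- by move: N2; rewrite -e hT.
- by rewrite /split5 !deg_nxt d hT !nxtK m1 e prvK m2.
Qed.

Lemma apex_le m : diamond M m -> ~~ split5 M (s (s m)) -> weight M m <= -1.
Proof.
move=> h hB; have [N3 N4] := diamond_side h.
case: (apexP h) => [[ht]|[_]|[_]]; first by rewrite ht in hB.
  by lra.
have O3 := charge_side N3; have O4 := charge_side N4 => e ->.
case: (boolP (rhomb M (s m))) => [/rhomb_lt2 k1|/(charge_open N3)]; last by lra.
case: (boolP (rhomb M (si (si m)))) => [/rhomb_lt2 k2|/(charge_open N4)]; last by lra.
lra.
Qed.

Lemma diamond_rich_nsplit5 m : diamond M m -> quiet M (fi m) -> quiet M (f (si m)) ->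
  rich M (s (s m)) -> ~~ split5 M (s (s (s (f m)))) ->
  (~~ rhomb M (si (f m)) ->
   angle (s (s (f m))) + angle (si (f m)) = 4 ->
   weight M (f m) = 7 + charge M (s (s (f m))) + charge M (si (f m)) ->
   diamondsum M m <= 0) ->
  (~~ rhomb M (s (s (f m))) ->
   angle (s (s (f m))) + angle (si (f m)) = 4 ->
   weight M (f m) = 7 + charge M (s (s (f m))) + charge M (si (f m)) ->
   diamondsum M m <= 0) ->
  diamondsum M m <= 0.
Proof.
move=> h q1 q2 fA hB c1 c2; have h' := diamond_rot h.
have := apexP h'; rewrite weight_nxt nxtK; case=> [[ht]|[_ hw]|[_]].
- by rewrite ht in hB.
- have hA := rich_split5 fA.
  rewrite diamondsumE //.
  have := lefttip_le h q1; have := righttip_le h q2;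
    rewrite hA hB !andbF !andbT (payout_nsplit5 hB).
  have := diamond_payout h fA; have e0 := excessR_ge0 M (s (s m)).
  have [wa _] := weight_split5_le0 h hA.
  have [y1 y2 y3 _ _] := diamond_lefttip h; have [x1 x2 x3 _ _] := diamond_righttip h.
  have Hy : ~~ split5 M (fi m) -> share M (fi m) <= 0 by exact: tip_le0.
  have Hx : ~~ split5 M (f (si m)) -> share M (f (si m)) <= 0 by exact: tip_le0.
  have := @b2r_le1 R (rich M (fi m)); have := @b2r_le1 R (rich M (f (si m))).
  case: (boolP (split5 M (fi m))) Hy => ty Hy;
    case: (boolP (split5 M (f (si m)))) Hx => tx Hx;
   try have := Hy isT; try have := Hx isT; clear -wa hw e0; rewrite /b2r /=; lra.
- move=> e4 wb; case: (boolP (rhomb M (si (f m)))) => r1; last exact: c1.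
  case: (boolP (rhomb M (s (s (f m))))) => r2; last exact: c2.
  have := rhomb_lt2 r1; have := rhomb_lt2 r2; lra.
Qed.

End DiamondSymmetry.

(** * Diamonds with a contested tip *)

Section DiamondDoubled.
Context {R : realFieldType} {D : finType}.
Variable M : angle_map R D.
Notation s := (nxt M).
Notation si := (prv M).
Notation f := (fnx M).
Notation fi := (fpv M).
Notation M' := (mirror M).
Notation angle := (angle M).

(** The isolated triangle of the contested vertex is half of this diamond, so the tip receives a
    payout, at most 1. In return, [path_doubled_apex] makes the second apex negative, and
    [tri_outer] keeps the right tip from having the pattern of [split5] when the first apex is
    positive. *)
Lemma diamond_doubled m : diamond M m -> doubled M (fi m) -> diamondsum M m <= 0.
Proof.
move=> h hd; rewrite diamondsumE //.
have h' := diamond_rot h; have [m1 m2] := andP h.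
have [hz hT hex] := doubledP hd; rewrite fpvK in hT hex.
have [hF hn _] := and3P hd.
have [r1 r2 r3 r4] := diamond_rhombE h.
have p1 : rhomb M (s m) by rewrite -r1 rich_rhomb'.
have p3 : rhomb M (si (f m)) by rewrite -r3 rich_rhomb.
have hA : split5 M (s (s m)) by apply: diamond_split5.
have hB' : ~ split5 M (si (si (f m))) by exact: path_doubled_apex hF hz hA m2.
have hB : ~~ split5 M (s (s (s (f m)))).
  by apply/negP => ht; apply: hB'; rewrite (lone_rot h ht).
have tyT := rich_split5 hF.
have hty : share M (fi m) <= 1.
  rewrite share_split5 // /payout.
  have -> : claimR M' (fi m) = 0.
    case: (claimRP M' (fi m)) => // [[_ ht _ _]|[_ hd' _ hT']]; exfalso.
      move: ht; rewrite split5_mirror => /deg_split5.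
      change (tipR (mirror M') (fi m)) with (tipR M (fi m)).
      by have [-> _ _] := needR_tip hn.
    apply: hB'; rewrite -split5_mirror; apply: (@diamond_split5 R D M' (f m)).
    - by case/andP: h'; rewrite nxtK /diamond /= => k1 k2; apply/andP; split.
    - by rewrite rhomb_mirror.
    - by move: hT'; rewrite /= tri_fifi.
  rewrite addr0; case: (claimRP M (fi m)) => [->|[_ _ -> _]|[_ _ -> _]] //.
    exact: excessR_le1.
have wb := apex_le h' hB; rewrite weight_nxt in wb.
rewrite (payout_nsplit5 hB).
have [wa wa'] := weight_split5_le0 h hA.
have [y1 y2 y3 _ _] := diamond_lefttip h; have [x1 x2 x3 _ _] := diamond_righttip h.
case: (boolP (rich M (s (s m)))) => fA; last first.
  have hx : share M (f (si m)) <= 0.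
    case: (boolP (split5 M (f (si m)))) => tx; last exact: tip_le0.
    rewrite share_split5 // payout_nrich //; apply/negP => /rich_rhomb;
      rewrite r2 => k.
    by move: fA; rewrite diamond_rich // hA p1 k.
  rewrite (payout_nrich fA); have := wa' fA; clear -hx wb hty; lra.
have ho := diamond_payout h fA; rewrite (b2rT tyT) in ho.
have tx : ~~ split5 M (f (si m)).
  apply/negP => tx; have := @tri_outer _ _ M (s (s m)) fA.
  have [_ _ _ ->] := diamond_lone h hA; move/(_ tx).
  have [_ _ _ eo] := rhomb_fpv (rich_rhomb' hF).
  have g3 : f (f (f (si (fi m)))) = s m by rewrite -eo fpvK fpv_prv fpvK.
  have -> : s (f (s (s m))) = s (si (f (f (si (fi m))))).
    by rewrite nxt_fnx nxtK -g3 fnxK prvK.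
  by have [_ -> _ _ _] := split5P (rich_split5 hz).
rewrite (b2rF tx) in ho; have e0 := excessR_ge0 M (s (s m)).
have hx := tip_le0 x1 x2 x3 tx.
have := apexP h'; rewrite weight_nxt nxtK; case=> [[ht]|[_ hw]|[_]].
- by rewrite ht in hB.
- clear -wa hw ho hx hty e0; lra.
have [N3 N4] := diamond_side h'; rewrite nxtK in N4.
move=> e4 hwb; have O1 := charge_rhomb p3.
have nq2 : ~~ rhomb M (s (s (f m))).
  by apply/negP => /rhomb_lt2; have := rhomb_lt2 p3; clear -e4; lra.
have O2 := charge_open N3 nq2.
have hor : ~~ rhomb M (s (f (si m))) || ~~ rhomb M (si (f (si m))) by rewrite
  r4 nq2 orbT.
case: (tipP x1 x2 x3 tx) => [[hS _ /(_ hor)]|[hS]|[hS _]|[hS _ _ _ _]];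
  try by clear -wa ho hty e0 hwb O1 O2; lra.
have hom : charge M (s (s (f m))) <=
  7 - 4 * angle (s (s (f m))) - 2 * angle (si (f (si m))).
  have [_ _ _ _ ->] := diamond_righttip h.
  rewrite /charge; have := angle_ge1 M (fi (s (s (f m)))); clear; lra.
have [s1 s2 s3 s4] := diamond_sides h.
move: (fA); rewrite diamond_rich // hA p1 /= => k2.
rewrite p1 p3 k2 (negbTE nq2) /= in s1 s2 s3 s4.
case: s1 => [[_ s1]|[]//]; case: s2 => [[_ s2]|[]//].
case: s3 => [[_ s3]|[]//]; case: s4 => [[]//|[_ s4]].
have [_ _ _ _ [_ _ ea]] := split5P hA.
have [la1 la2 _ _] := diamond_lone h hA; rewrite la1 la2 in ea.
have [_ _ _ _ [_ _ ey]] := split5P tyT.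
have l2 := rhomb_lt2 k2.
clear -wa ho hty hx e0 hwb O1 hom s1 s2 s3 ea ey hS e4 l2; lra.
Qed.

End DiamondDoubled.

Section DiamondAll.
Context {R : realFieldType} {D : finType}.
Variable M : angle_map R D.
Notation s := (nxt M).
Notation si := (prv M).
Notation f := (fnx M).
Notation fi := (fpv M).

Lemma diamond_mirror_b m : fi (si m) = s (f m).
Proof. exact: fpv_prv. Qed.

Lemma diamond_rich_split5_all m : diamond M m -> quiet M (fi m) ->
  quiet M (f (si m)) ->
  rich M (s (s m)) -> split5 M (s (s (s (f m)))) -> diamondsum M m <= 0.
Proof.
move=> h q1 q2 fA hB; have h' := diamond_rot h.
case: (boolP (rich M (s (s (s (f m)))))) => fB; first exact: diamond_rich_rich.
case: (boolP (rhomb M (si (f m)))) => r1; last exact: diamond_rich_split5.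
case: (boolP (rhomb M (s (s (f m))))) => r2.
  by move: fB; rewrite diamond_rich // nxtK hB r1 r2.
rewrite -diamondsum_mirror //; apply: diamond_rich_split5;
  rewrite /= ?diamond_mirror_b.
- exact: diamond_mirror.
- by apply/quiet_mirror.
- by rewrite prvK; apply/quiet_mirror.
- by rewrite rich_mirror; have [-> _] := diamond_lone_mirror h.
- by rewrite split5_mirror; have [_ ->] := diamond_lone_mirror h'.
- by rewrite rhomb_mirror.
Qed.

Lemma diamond_rich_nsplit5_all m : diamond M m -> quiet M (fi m) ->
  quiet M (f (si m)) ->
  rich M (s (s m)) -> ~~ split5 M (s (s (s (f m)))) -> diamondsum M m <= 0.
Proof.
move=> h q1 q2 fA hB; have h' := diamond_rot h.
apply: diamond_rich_nsplit5 => // r1 e4 hw; first exact: diamond_rich_nsplit5_aux.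
rewrite -diamondsum_mirror //; apply: diamond_rich_nsplit5_aux;
  rewrite /= ?diamond_mirror_b ?nxtK.
- exact: diamond_mirror.
- by apply/quiet_mirror.
- by rewrite prvK; apply/quiet_mirror.
- by rewrite rich_mirror; have [-> _] := diamond_lone_mirror h.
- rewrite split5_mirror; have [_] := diamond_lone_mirror h'; rewrite nxtK => -> //.
- by rewrite rhomb_mirror.
- by rewrite addrC.
- by rewrite weight_mirror weight_nxt hw !charge_mirror; ring.
Qed.

Lemma diamond_quiet m : diamond M m -> quiet M (fi m) -> quiet M (f (si m)) ->
  split5 M (s (s m)) -> diamondsum M m <= 0.
Proof.
move=> h q1 q2 hA; have h' := diamond_rot h; have [m1 m2] := andP h.
have q1' : quiet M (fi (s (f m))) by rewrite fi_rot.
have q2' : quiet M (f (si (s (f m)))) by rewrite nxtK tri_ff.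
have e1 : s (f (s (f m))) = m by rewrite f_rot prvK.
case: (boolP (rich M (s (s m)))) => fA.
  by case: (boolP (split5 M (s (s (s (f m)))))) => hB;
    [exact: diamond_rich_split5_all|exact: diamond_rich_nsplit5_all].
case: (boolP (split5 M (s (s (s (f m)))))) => hB; last exact: diamond_nrich_nsplit5.
case: (boolP (rich M (s (s (s (f m)))))) => fB; last exact: diamond_nrich_nrich.
by rewrite -diamondsum_rot //; apply: diamond_rich_split5_all; rewrite ?e1.
Qed.

Lemma excessR_quiet t : ~~ doubled M t -> excessR M t = 0.
Proof. by move=> h; apply/eqP; apply: contraNT h => /excessR_doubled. Qed.

End DiamondAll.

(** * The weighted count *)

Section Total.
Context {R : realFieldType} {D : finType}.
Variable M : angle_map R D.
Notation s := (nxt M).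
Notation si := (prv M).
Notation f := (fnx M).
Notation fi := (fpv M).
Notation M' := (mirror M).
Notation angle := (angle M).

(** Half turns and reflections bring any contested tip to the left position. *)
Lemma diamond_le0 m : diamond M m -> diamondsum M m <= 0.
Proof.
move=> h; have h' := diamond_rot h; have [m1 m2] := andP h.
case: (boolP (doubled M (fi m))) => d1; first exact: diamond_doubled.
case: (boolP (doubled M (f (si m)))) => d2.
  by rewrite -diamondsum_rot //; apply: diamond_doubled; rewrite ?fi_rot.
case: (boolP (doubled M' (f (si m)))) => d3.
  by rewrite -diamondsum_mirror //; apply: diamond_doubled; [exact: diamond_mirror|].
case: (boolP (doubled M' (fi m))) => d4.
  rewrite -diamondsum_rot // -diamondsum_mirror //; apply: diamond_doubled;
    first exact: diamond_mirror.
  by rewrite /= nxtK tri_ff.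
have q1 : quiet M (fi m) by split; apply: excessR_quiet.
have q2 : quiet M (f (si m)) by split; apply: excessR_quiet.
case: (boolP (split5 M (s (s m)))) => hA; first exact: diamond_quiet.
case: (boolP (split5 M (s (s (s (f m)))))) => hB; last exact: diamond_nsplit5_nsplit5.
rewrite -diamondsum_rot //; apply: diamond_quiet => //; first by rewrite fi_rot.
by rewrite nxtK tri_ff.
Qed.

Lemma sum_fnx (h : D -> R) : \sum_c h (f c) = \sum_c h c.
Proof. by rewrite [RHS](reindex_inj (can_inj (fnxK M))). Qed.
Lemma sum_fpv (h : D -> R) : \sum_c h (fi c) = \sum_c h c.
Proof. by rewrite [RHS](reindex_inj (can_inj (fpvK M))). Qed.
Lemma sum_edge (h : D -> R) : \sum_c h (s (f c)) = \sum_c h c.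
Proof. by rewrite (sum_fnx (fun c => h (s c))) sum_nxt. Qed.

Definition trisum c := trishare M c + trishare M (f c) + trishare M (fi c).
Definition in_diamond c : R := if diamond M c then 1 else 0.

(** Two shared sides of a triangle would meet in a vertex with three consecutive triangles. *)
Lemma diamond_unique c : tri M c ->
  in_diamond c + in_diamond (f c) + in_diamond (fi c) = 0 \/
  in_diamond c + in_diamond (f c) + in_diamond (fi c) = 1.
Proof.
have key x : diamond M x -> diamond M (f x) = false /\ diamond M (fi x) = false.
  move=> h; have [h1 h2] := diamond_side h;
    have [h3 h4] := diamond_side (diamond_rot h).
  have [_ _ y3 _ _] := diamond_lefttip h.
  split; apply/negP => /andP[_]; last by rewrite (negbTE y3).
  by move: h4; rewrite nxtK => /negbTE ->.
move=> hT; rewrite /in_diamond.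
case: (boolP (diamond M c)) => h1.
  by have [-> ->] := key _ h1; right; rewrite !addr0.
case: (boolP (diamond M (f c))) => h2.
  have [h3 _] := key _ h2; rewrite tri_ff // in h3.
  by rewrite h3; right; rewrite add0r addr0.
by case: ifP => _; [right|left]; rewrite !add0r.
Qed.

(** On triangles the first factor is the indicator of lying in no diamond. *)
Lemma trisum_le0 c : (1 - in_diamond c - in_diamond (f c) - in_diamond (fi c))
  * trisum c <= 0.
Proof.
case: (boolP (tri M c)) => hT; last first.
  by rewrite /trisum /trishare tri_fnx tri_fpv (negbTE hT) !addr0 mulr0.
case: (diamond_unique hT) => h; last first.
  have -> : 1 - in_diamond c - in_diamond (f c) - in_diamond (fi c) = 0 by lra.
  by rewrite mul0r.
have -> : 1 - in_diamond c - in_diamond (f c) - in_diamond (fi c) = 1 by lra.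
have [n1 n2 n3] : [/\ ~~ diamond M c, ~~ diamond M (f c) & ~~ diamond M (fi c)].
  by move: h; rewrite /in_diamond; do 3 case: ifP => _; split=> //; move: h; lra.
have lo x : tri M x -> ~~ diamond M x -> ~~ diamond M (fi x) -> lone M x.
  move=> tx; rewrite /diamond /lone tx tri_fpv tx /= => h1 h2; rewrite h1 andbT.
  by move: h2; rewrite -fnx_nxt tri_fnx.
rewrite mul1r /trisum /trishare tri_fnx tri_fpv hT; apply: single_le0;
  apply: lo => //.
- by rewrite tri_fnx.
- by rewrite fnxK.
- by rewrite tri_fpv.
- by rewrite tri_fifi.
Qed.

(** Sums over corners count a triangle three times and a diamond twice, once from each end of its
    common side. *)
Lemma sum_trishare_le0 : \sum_c trishare M c <= 0.
Proof.
have h1 : \sum_c (1 - in_diamond c - in_diamond (f c) - in_diamond (fi c)) *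
  trisum c <= 0.
  by apply: sumr_le0 => c _; exact: trisum_le0.
have h2 : \sum_c in_diamond c * (trisum c + trisum (s (f c))) <= 0.
  apply: sumr_le0 => c _; rewrite /in_diamond; case: ifP => hd; last by rewrite mul0r.
  rewrite mul1r; apply: le_trans (diamond_le0 hd).
  have h3 := diamond_rot hd; have [m1 m2] := andP hd; have [m3 m4] := andP h3.
  rewrite /trisum /diamondsum /trishare tri_fnx tri_fpv (fi_rot m2) f_rot m1 m3
    m2 tri_fnx m2.
  rewrite le_eqVlt; apply/orP; left; apply/eqP; ring.
have e1 : \sum_c in_diamond c * trisum (s (f c)) = \sum_c in_diamond c * trisum c.
  rewrite -[RHS]sum_edge; apply: eq_bigr => c _.
  by rewrite /in_diamond /diamond nxtK tri_fnx nxt_fnx tri_fpv andbC.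
have e2 : \sum_c in_diamond (f c) * trisum c = \sum_c in_diamond c * trisum c.
  rewrite -[RHS]sum_fnx; apply: eq_bigr => c _.
  case: (boolP (tri M c)) => hT; last first.
    by rewrite /in_diamond /diamond tri_fnx (negbTE hT) !mul0r.
  by rewrite /trisum fnxK tri_ff //; ring.
have e3 : \sum_c in_diamond (fi c) * trisum c = \sum_c in_diamond c * trisum c.
  rewrite -[RHS]sum_fpv; apply: eq_bigr => c _.
  case: (boolP (tri M c)) => hT; last first.
    by rewrite /in_diamond /diamond tri_fpv (negbTE hT) !mul0r.
  by rewrite /trisum fpvK tri_fifi //; ring.
have e4 : \sum_c trisum c = 3 * \sum_c trishare M c.
  rewrite /trisum !big_split /= sum_fnx sum_fpv; ring.
have h1' : \sum_c (1 - in_diamond c - in_diamond (f c) - in_diamond (fi c)) *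
  trisum c =
   \sum_c trisum c - 3 * \sum_c in_diamond c * trisum c.
  transitivity (\sum_c trisum c - (\sum_c in_diamond c * trisum c
      + \sum_c in_diamond (f c) * trisum c + \sum_c in_diamond (fi c) * trisum c)).
    by rewrite -!big_split -sumrB /=; apply: eq_bigr => c _; ring.
  rewrite e2 e3; ring.
have h2' : \sum_c in_diamond c * (trisum c + trisum (s (f c))) = 2 * \sum_c
  in_diamond c * trisum c.
  transitivity (\sum_c in_diamond c * trisum c + \sum_c in_diamond c * trisum
    (s (f c))).
    by rewrite -big_split /=; apply: eq_bigr => c _; ring.
  rewrite e1; ring.
lra.
Qed.

(** The corners number twice the edges, and the inverse degrees add up to the number of vertices. *)
Theorem angle_map_bound :
  9 * #|D|%:R <= 43 * \sum_c (deg M c)%:R^-1 :> R.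
Proof.
have h1 : \sum_c (charge M c + 5 / (deg M c)%:R - trishare M c) <= 0.
  apply: (sum_vertex_sum_le0 (M := M)) => c.
  have := vertex_share M c; rewrite /weight /vertex_sum !deg_nxt !prv_deg.
  case: (degP M c) => [[-> _ _]|[-> _ _]|[-> _ _]] /=; lra.
have h2 : \sum_c angle c = \sum_c 6 / (deg M c)%:R.
  rewrite -(sum_vertex_sum M); apply: eq_bigr => c _; congr (_ / _).
  by rewrite /vertex_sum; case: (degP M c) => [[-> _ <-]|[-> _ <-]|[-> _ <-]] /=;
    ring.
have h3 : \sum_c charge M c = 9 * #|D|%:R - 8 * \sum_c angle c.
  rewrite /charge !sumrB -!mulr_sumr sum_fnx sum_fpv sumr_const.
  rewrite -mulr_natr; ring.
have h4 := sum_trishare_le0.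
rewrite sumrB big_split /= h3 h2 -!mulr_sumr in h1.
lra.
Qed.

End Total.

(** * Angles of unit vectors *)

Section Sextant.
Context {R : realType}.
Implicit Types x y z : R.

(* Angles are measured in sixths of a full turn, so that triangles have angle 1. *)
Definition cos6 x : R := cos (x * (pi / 3)).
Definition sin6 x : R := sin (x * (pi / 3)).

Lemma cos6D x y : cos6 (x + y) = cos6 x * cos6 y - sin6 x * sin6 y.
Proof. by rewrite /cos6 /sin6 mulrDl cosD. Qed.
Lemma sin6D x y : sin6 (x + y) = sin6 x * cos6 y + cos6 x * sin6 y.
Proof. by rewrite /cos6 /sin6 mulrDl sinD. Qed.
Lemma cos6N x : cos6 (- x) = cos6 x.
Proof. by rewrite /cos6 mulNr cosN. Qed.
Lemma sin6N x : sin6 (- x) = - sin6 x.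
Proof. by rewrite /sin6 mulNr sinN. Qed.
Lemma cos6_0 : cos6 0 = 1. Proof. by rewrite /cos6 mul0r cos0. Qed.
Lemma cos6_sin6 x : cos6 x ^+ 2 + sin6 x ^+ 2 = 1.
Proof. exact: cos2Dsin2. Qed.
Lemma cos6B x y : cos6 (x - y) = cos6 x * cos6 y + sin6 x * sin6 y.
Proof. by rewrite cos6D cos6N sin6N; ring. Qed.
Lemma cos6_3 : cos6 3 = -1.
Proof. by rewrite /cos6 mulrC divfK ?cospi // pnatr_eq0. Qed.
Lemma sin6_3 : sin6 3 = 0.
Proof. by rewrite /sin6 mulrC divfK ?sinpi // pnatr_eq0. Qed.
Lemma cos6D3 x : cos6 (x + 3) = - cos6 x.
Proof. by rewrite cos6D cos6_3 sin6_3; ring. Qed.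
Lemma sin6D3 x : sin6 (x + 3) = - sin6 x.
Proof. by rewrite sin6D cos6_3 sin6_3; ring. Qed.
Lemma cos6_lt x y : 0 <= x -> x < y -> y <= 3 -> cos6 y < cos6 x.
Proof.
move=> h1 h2 h3; have p : 0 < pi / 3 :> R by rewrite divr_gt0 // pi_gt0.
have e : 3 * (pi / 3) = pi :> R by field.
have r z : 0 <= z -> z <= 3 -> z * (pi / 3) \in `[0, pi].
  move=> z0 z3; rewrite in_itv /= mulr_ge0 ?(ltW p) //=.
  by rewrite -[leRHS]e ler_pM2r.
by rewrite /cos6 ltr_cos ?ltr_pM2r ?r //; lra.
Qed.
Lemma cos6_double x : cos6 (2 * x) = 2 * cos6 x ^+ 2 - 1.
Proof.
have -> : 2 * x = x + x by ring.
rewrite cos6D; have := cos6_sin6 x; nra.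
Qed.
Lemma cos6_right : cos6 (3 / 2) = 0.
Proof.
have := cos6_double (3/2); have -> : 2 * (3 / 2) = 3 :> R by field.
rewrite cos6_3 => h; apply/eqP; rewrite -sqrf_eq0; apply/eqP; lra.
Qed.
Lemma cos6_gt0 x : 0 <= x -> x < 3 / 2 -> 0 < cos6 x.
Proof. by move=> h1 h2; rewrite -cos6_right; apply: cos6_lt => //; lra. Qed.
Lemma cos6_1 : cos6 1 = 1 / 2.
Proof.
have h := cos6_double 1; have h0 : 0 < cos6 1 by apply: cos6_gt0; lra.
(* Doubling now gives a quadratic equation with roots 1/2 and -1. *)
have e2 : 2 * 1 = -1 + 3 :> R by lra.
have e : cos6 (2 * 1) = - cos6 1 by rewrite e2 cos6D3 cos6N.
nra.
Qed.
Lemma cos6_le_half x : 0 < x -> x < 6 -> cos6 x <= 1 / 2 -> 1 <= x <= 5.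
Proof.
move=> h1 h2 h3; apply/andP; split.
  rewrite leNgt; apply/negP => h; have : cos6 1 < cos6 x by apply: cos6_lt; lra.
  by rewrite cos6_1; lra.
rewrite leNgt; apply/negP => h; have : cos6 1 < cos6 (6 - x) by apply: cos6_lt; lra.
have -> : 6 - x = - x + 3 + 3 by ring.
by rewrite !cos6D3 cos6N cos6_1; lra.
Qed.

(** Congruence of angles modulo a full turn, without integers. *)
Definition codir x y := cos6 x = cos6 y /\ sin6 x = sin6 y.
Lemma codir_refl x : codir x x. Proof. by []. Qed.
Lemma codir_sym x y : codir x y -> codir y x. Proof. by case. Qed.
Lemma codir_trans x y z : codir x y -> codir y z -> codir x z.
Proof. by case=> h1 h2 [h3 h4]; split; rewrite ?h1 ?h2. Qed.
Lemma codirD x y z : codir x y -> codir (x + z) (y + z).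
Proof. by case=> h1 h2; rewrite /codir !cos6D !sin6D h1 h2. Qed.
Lemma codir6 x : codir (x + 6) x.
Proof.
have -> : x + 6 = x + 3 + 3 by ring.
by rewrite /codir !cos6D3 !sin6D3 !opprK.
Qed.
Lemma codir_cos6 x y : codir x y <-> cos6 (x - y) = 1.
Proof.
split=> [[h1 h2]|]; rewrite cos6B.
  by rewrite h1 h2 -!expr2 cos6_sin6.
move=> h; have h1 := cos6_sin6 x; have h2 := cos6_sin6 y.
have : (cos6 x - cos6 y) ^+ 2 + (sin6 x - sin6 y) ^+ 2 = 0 by lra.
move/eqP; rewrite paddr_eq0 ?sqr_ge0 // !sqrf_eq0 !subr_eq0.
by case/andP => /eqP h3 /eqP h4; split.
Qed.
Lemma codir_eq x y : 0 <= x < 6 -> 0 <= y < 6 -> codir x y -> x = y.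
Proof.
wlog h : x y / x <= y => [hw hx hy hs|].
  case/orP: (le_total x y) => h; first exact: hw.
  by apply/esym/hw => //; exact: codir_sym.
move=> /andP[h1 h2] /andP[h3 h4] /codir_sym /codir_cos6 hs.
apply/eqP; apply: contraT => hne.
have hlt : 0 < y - x by rewrite subr_gt0 lt_neqAle hne h.
case: (lerP (y - x) 3) => h5.
  by have := cos6_lt (lexx 0) hlt h5; rewrite hs cos6_0 ltxx.
have : cos6 (6 - (y - x)) < cos6 0 by apply: cos6_lt; lra.
have -> : 6 - (y - x) = - (y - x) + 3 + 3 by ring.
by rewrite !cos6D3 cos6N hs cos6_0; lra.
Qed.

Lemma direction (a b : R) : a ^+ 2 + b ^+ 2 = 1 ->
  exists t, [/\ 0 <= t < 6, cos6 t = a & sin6 t = b].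
Proof.
move=> h; have ha : -1 <= a <= 1.
  apply/andP; split; nra.
have p : 0 < pi :> R by exact: pi_gt0.
have p0 : pi != 0 :> R by rewrite gt_eqF.
have hb : Num.sqrt (1 - a ^+ 2) = `|b|.
  have -> : 1 - a ^+ 2 = b ^+ 2 by lra.
  by rewrite sqrtr_sqr.
have c0 := acos_ge0 ha; have c1 := acos_lepi ha.
have e (t : R) : t * 3 / pi * (pi / 3) = t.
  by rewrite mulrA divfK // mulfK // pnatr_eq0.
case: (lerP 0 b) => sb.
  exists (acos a * 3 / pi); split.
  - apply/andP; split; first by rewrite divr_ge0 ?mulr_ge0 // ltW.
    by rewrite ltr_pdivrMr //; lra.
  - by rewrite /cos6 e acosK // in_itv.
  - by rewrite /sin6 e sin_acos // hb ger0_norm.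
have c2 : 0 < acos a.
  rewrite lt_neqAle c0 andbT eq_sym; apply/negP => /eqP h0.
  have : cos (acos a) = a by rewrite acosK // in_itv.
  rewrite h0 cos0 => h1; nra.
exists (6 - acos a * 3 / pi); split.
- have : 0 < acos a * 3 / pi by rewrite divr_gt0 ?mulr_gt0.
  have : acos a * 3 / pi <= 3 by rewrite ler_pdivrMr //; lra.
  lra.
- have -> : 6 - acos a * 3 / pi = - (acos a * 3 / pi) + 3 + 3 by ring.
  by rewrite !cos6D3 opprK cos6N /cos6 e acosK // in_itv.
- have -> : 6 - acos a * 3 / pi = - (acos a * 3 / pi) + 3 + 3 by ring.
  by rewrite !sin6D3 opprK sin6N /sin6 e sin_acos // hb ltr0_norm // opprK.
Qed.

(* The ends of a path of three unit edges turning by [x] and then [y] on the same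
   side are at squared distance 3 - 2 cos x - 2 cos y + 2 cos (x + y) < 1. *)
Lemma pair_lt3 x y : 0 < x -> 0 < y -> x + y < 3 ->
  1 + cos6 (x + y) < cos6 x + cos6 y.
Proof.
wlog h : x y / x <= y => [hw h1 h2 h3|].
  case/orP: (le_total x y) => h; first exact: hw.
  have := hw _ _ h h2 h1; rewrite [y + x]addrC [cos6 y + _]addrC; exact.
move=> h1 h2 h3.
(* With half sum m and half difference k the claim reads 2 cos(m)^2 < 2 cos(m) cos(k). *)
pose m := (x + y) / 2; pose k := (y - x) / 2.
have -> : x + y = 2 * m by rewrite /m; field.
have -> : cos6 x = cos6 m * cos6 k + sin6 m * sin6 k.
  by rewrite -cos6B; congr cos6; rewrite /m /k; field.
have -> : cos6 y = cos6 m * cos6 k - sin6 m * sin6 k.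
  by rewrite -cos6D; congr cos6; rewrite /m /k; field.
have h4 : 0 < cos6 m by apply: cos6_gt0; rewrite /m; lra.
have h5 : cos6 m < cos6 k by apply: cos6_lt; rewrite /m /k; lra.
rewrite cos6_double; nra.
Qed.

Lemma sin6_sq x : sin6 x ^+ 2 = (1 - cos6 (2 * x)) / 2.
Proof. rewrite cos6_double; have := cos6_sin6 x; lra. Qed.

(** The expression would be sin(y1 + y2)^2 if g were y1 + y2; a larger g decreases it, and
    sin(1/2)^2 = 1/4 in these units. It vanishes only if both sines do. *)
Lemma open_lt1 y1 y2 g : 0 <= y1 -> 0 <= y2 -> y1 + y2 < 1 / 2 ->
  1 / 2 <= g -> g < 3 ->
  sin6 y1 ^+ 2 + sin6 y2 ^+ 2 + 2 * sin6 y1 * sin6 y2 * cos6 g < 1 / 4 /\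
  (sin6 y1 ^+ 2 + sin6 y2 ^+ 2 + 2 * sin6 y1 * sin6 y2 * cos6 g = 0 -> y1 = 0).
Proof.
move=> h1 h2 h3 h4 h5.
have s_ge0 y : 0 <= y -> y < 1 / 2 -> 0 <= sin6 y.
  move=> hy hy'; rewrite /sin6 sin_ge0_pi //; have p := @pi_gt0 R.
  apply/andP; split; first by rewrite mulr_ge0 // divr_ge0 // ltW.
  by rewrite mulrA ler_pdivrMr //; nra.
have s1 : 0 <= sin6 y1 by apply: s_ge0; lra.
have s2 : 0 <= sin6 y2 by apply: s_ge0; lra.
have c1 : cos6 g < cos6 (y1 + y2) by apply: cos6_lt; lra.
have c2 : -1 < cos6 g by rewrite -cos6_3; apply: cos6_lt; lra.
have s12 : 0 <= sin6 y1 * sin6 y2 by rewrite mulr_ge0.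
split.
  have : sin6 (y1 + y2) ^+ 2 < 1 / 4.
    rewrite sin6_sq; have : cos6 1 < cos6 (2 * (y1 + y2)) by apply: cos6_lt; lra.
    rewrite cos6_1; lra.
  apply: le_lt_trans.
  have -> : sin6 (y1 + y2) ^+ 2 =
      sin6 y1 ^+ 2 + sin6 y2 ^+ 2 + 2 * sin6 y1 * sin6 y2 * cos6 (y1 + y2).
    have e1 : cos6 y1 ^+ 2 = 1 - sin6 y1 ^+ 2 by have := cos6_sin6 y1; lra.
    have e2 : cos6 y2 ^+ 2 = 1 - sin6 y2 ^+ 2 by have := cos6_sin6 y2; lra.
    transitivity (sin6 y1 ^+ 2 * cos6 y2 ^+ 2 + cos6 y1 ^+ 2 * sin6 y2 ^+ 2
      + 2 * sin6 y1 * cos6 y2 * cos6 y1 * sin6 y2); first by rewrite sin6D; ring.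
    by rewrite cos6D e1 e2; ring.
  nra.
move=> h0.
have e0 : sin6 y1 * sin6 y2 = 0.
  have q1 : 0 <= sin6 y1 * sin6 y2 * (1 + cos6 g) by rewrite mulr_ge0 //; lra.
  have q2 := sqr_ge0 (sin6 y1 - sin6 y2).
  have q3 : (sin6 y1 - sin6 y2) ^+ 2 + 2 * (sin6 y1 * sin6 y2 * (1 + cos6 g)) = 0.
    by rewrite -[RHS]h0; ring.
  have /eqP : sin6 y1 * sin6 y2 * (1 + cos6 g) = 0 by lra.
  rewrite mulf_eq0 => /orP[/eqP //|/eqP]; lra.
have : sin6 y1 ^+ 2 = 0.
  have := sqr_ge0 (sin6 y1); have := sqr_ge0 (sin6 y2).
  move: h0; rewrite -[2 * _ * _]mulrA e0 mulr0 mul0r; lra.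
rewrite sin6_sq => e1.
apply/eqP; apply: contraT => hn.
have : cos6 (2 * y1) < cos6 0.
  apply: cos6_lt => //; last lra.
  by rewrite mulr_gt0 // lt_neqAle eq_sym hn.
rewrite cos6_0; lra.
Qed.

End Sextant.

(** * Darts of a penny graph *)

Section Darts.
Context {R : realType} (V : finType) (X Y : V -> R).

Definition dist2 (v w : V) : R := (X v - X w) ^+ 2 + (Y v - Y w) ^+ 2.
Definition adj (v w : V) : bool := dist2 v w == 1.
Definition dart := {d : V * V | adj d.1 d.2}.

Hypothesis sep : forall v w, v != w -> 1 <= dist2 v w.

Definition org (d : dart) : V := (val d).1.
Definition tgt (d : dart) : V := (val d).2.

Lemma adj_sym v w : adj v w = adj w v.
Proof. by rewrite /adj /dist2; congr (_ == _); ring. Qed.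
Lemma dartP (d : dart) : adj (org d) (tgt d).
Proof. exact: (valP d). Qed.
Definition mkdart v w (h : adj v w) : dart := exist _ (v, w) h.
Definition drev (d : dart) : dart := mkdart (etrans (adj_sym _ _) (dartP d)).

Lemma dart_eq (d1 d2 : dart) : org d1 = org d2 -> tgt d1 = tgt d2 -> d1 = d2.
Proof.
move=> h1 h2; apply: val_inj; rewrite [LHS]surjective_pairing [RHS]surjective_pairing.
by congr pair.
Qed.
Lemma org_rev d : org (drev d) = tgt d. Proof. by []. Qed.
Lemma tgt_rev d : tgt (drev d) = org d. Proof. by []. Qed.
Lemma revK : involutive drev. Proof. by move=> d; apply: dart_eq. Qed.

Lemma phi_ex (d : dart) : exists t,
  [/\ 0 <= t < 6, cos6 t = X (tgt d) - X (org d) & sin6 t = Y (tgt d) - Y (org d)].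
Proof.
apply: direction; have := dartP d; rewrite adj_sym => /eqP; rewrite /dist2 => <-;
  ring.
Qed.
Definition phi d : R := projT1 (cid (phi_ex d)).
Lemma phi_range d : 0 <= phi d < 6. Proof. by rewrite /phi; case: cid => /= t []. Qed.
Lemma cos6_phi d : cos6 (phi d) = X (tgt d) - X (org d).
Proof. by rewrite /phi; case: cid => /= t []. Qed.
Lemma sin6_phi d : sin6 (phi d) = Y (tgt d) - Y (org d).
Proof. by rewrite /phi; case: cid => /= t []. Qed.

Lemma eq_pt v w : X v = X w -> Y v = Y w -> v = w.
Proof.
move=> h1 h2; apply/eqP; apply: contraT => /sep; rewrite /dist2 h1 h2 !subrr.
by rewrite expr0n /= addr0 ler10.
Qed.
Lemma lt1_pt v w : dist2 v w < 1 -> v = w.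
Proof.
by move=> h; apply/eqP; apply: contraT => /sep; rewrite leNgt h.
Qed.

Lemma phi_codir d1 d2 : org d1 = org d2 -> codir (phi d1) (phi d2) -> d1 = d2.
Proof.
move=> h []; rewrite !cos6_phi !sin6_phi h => h1 h2; apply: dart_eq => //.
by apply: eq_pt; lra.
Qed.
Lemma phi_inj d1 d2 : org d1 = org d2 -> phi d1 = phi d2 -> d1 = d2.
Proof. by move=> h e; apply: phi_codir => //; rewrite e. Qed.

Lemma phi_rev d : codir (phi (drev d)) (phi d + 3).
Proof. by split; rewrite ?cos6D3 ?sin6D3 ?cos6_phi ?sin6_phi !(org_rev, tgt_rev);
  ring. Qed.

(** The value for equal darts is 6 and not 0, so that a dart is its own successor only if it is
    alone at its origin. *)
Definition gap (d1 d2 : dart) : R :=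
  if phi d1 < phi d2 then phi d2 - phi d1 else phi d2 - phi d1 + 6.

Lemma gap_range d1 d2 : 0 < gap d1 d2 <= 6.
Proof.
rewrite /gap; have := phi_range d1; have := phi_range d2.
case: (ltP (phi d1) (phi d2)) => h /andP[h1 h2] /andP[h3 h4]; apply/andP; split; lra.
Qed.
Lemma gap_codir d1 d2 : codir (phi d1 + gap d1 d2) (phi d2).
Proof.
rewrite /gap; case: ifP => _.
  by have -> : phi d1 + (phi d2 - phi d1) = phi d2 by ring.
have -> : phi d1 + (phi d2 - phi d1 + 6) = phi d2 + 6 by ring.
exact: codir6.
Qed.
Lemma gap_self d : gap d d = 6. Proof. by rewrite /gap ltxx subrr add0r. Qed.
Lemma gap_swap d1 d2 : org d1 = org d2 -> d1 != d2 -> gap d1 d2 + gap d2 d1 = 6.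
Proof.
move=> ho hn; have : phi d1 != phi d2 by apply: contra hn => /eqP /(phi_inj ho) ->.
by rewrite /gap neq_lt => /orP[] h; rewrite h (lt_gtF h); ring.
Qed.
Lemma gap_add d1 d2 d3 :
  gap d1 d2 + gap d2 d3 = gap d1 d3 \/ gap d1 d2 + gap d2 d3 = gap d1 d3 + 6.
Proof.
rewrite /gap.
case: (ltP (phi d1) (phi d2)) => h1; case: (ltP (phi d2) (phi d3)) => h2;
case: (ltP (phi d1) (phi d3)) => h3; try (by left; ring); try (by right; ring); lra.
Qed.

Lemma gapP d1 d2 x : 0 < x <= 6 -> codir (phi d1 + x) (phi d2) -> gap d1 d2 = x.
Proof.
move=> /andP[x0 x6] h; have /andP[g0 g6] := gap_range d1 d2.
have hs : codir (gap d1 d2) x.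
  have h1 := codir_trans (gap_codir d1 d2) (codir_sym h).
  have := codirD (- phi d1) h1.
  by rewrite ![phi d1 + _]addrC !addrK.
case: (ltP (gap d1 d2) 6) => h6; last first.
  have e6 : gap d1 d2 = 6 by lra.
  rewrite e6; case: (ltP x 6) => h7; last by lra.
  have e0 : codir 0 x.
    apply: codir_trans hs; rewrite e6 -[X in codir _ X]add0r; exact/codir_sym/codir6.
  have := codir_eq _ _ e0; rewrite lexx /= => /(_ _ _) h8.
  have e : 0 = x by apply: h8; lra.
  by rewrite -e ltxx in x0.
case: (ltP x 6) => h7; last first.
  have e6 : x = 6 by lra.
  have e0 : codir (gap d1 d2) 0.
    apply: codir_trans hs _; rewrite e6 -[X in codir X]add0r; exact: codir6.
  have e : gap d1 d2 = 0 by apply: codir_eq e0; lra.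
  by rewrite e ltxx in g0.
by apply: codir_eq hs; lra.
Qed.

Lemma gap_chord d1 d2 : org d1 = org d2 ->
  dist2 (tgt d1) (tgt d2) = 2 - 2 * cos6 (gap d1 d2).
Proof.
move=> h; have [e1 e2] := gap_codir d1 d2.
have := cos6_sin6 (phi d1); have := cos6_sin6 (phi d2).
have -> : cos6 (gap d1 d2) = cos6 (phi d2 - phi d1).
  have [] := codirD (- phi d1) (gap_codir d1 d2).
  by rewrite addrAC subrr add0r.
rewrite cos6B !cos6_phi !sin6_phi -h /dist2 => h1 h2.
lra.
Qed.

Lemma gap_ge1 d1 d2 : org d1 = org d2 -> d1 != d2 -> 1 <= gap d1 d2.
Proof.
move=> h hn; have hs := gap_swap h hn.
have /andP[g1 g2] := gap_range d1 d2; have /andP[g3 g4] := gap_range d2 d1.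
have hd : 1 <= dist2 (tgt d1) (tgt d2).
  by apply: sep; apply: contra hn => /eqP e; apply/eqP/dart_eq.
rewrite gap_chord // in hd.
have /andP[] // : 1 <= gap d1 d2 <= 5 by apply: cos6_le_half; lra.
Qed.

Definition dnext (d : dart) : dart :=
  [arg min_(d' < d | org d' == org d) gap d d']%O.

Lemma nextP d : org (dnext d) = org d /\
  forall d', org d' = org d -> gap d (dnext d) <= gap d d'.
Proof.
rewrite /dnext; case: arg_minP => // d' /eqP h1 h2; split=> // d'' h3.
by apply: h2; rewrite h3.
Qed.
Lemma org_next d : org (dnext d) = org d. Proof. by have [] := nextP d. Qed.
Lemma next_le d d' : org d' = org d -> gap d (dnext d) <= gap d d'.
Proof. by have [_] := nextP d; apply. Qed.

Definition theta d := gap d (dnext d).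

Lemma theta_range d : 0 < theta d <= 6. Proof. exact: gap_range. Qed.

Lemma next_inj : injective dnext.
Proof.
move=> d1 d2 h; apply/eqP; apply: contraT => hn.
have ho : org d1 = org d2 by rewrite -(org_next d1) h org_next.
have l1 := next_le (esym ho); have l2 := next_le ho.
have := gap_add d1 d2 (dnext d2); have := gap_add d2 d1 (dnext d1).
have := gap_swap ho hn; rewrite h in l1 *.
have /andP[] := gap_range d2 (dnext d2); have /andP[] := gap_range d1 (dnext d2).
have /andP[] := gap_range d1 d2; have /andP[] := gap_range d2 d1.
clear hn h ho; move=> ? ? ? ? ? ? ? ? ? [] ? [] ?; lra.
Qed.

Definition dprev : dart -> dart := invF next_inj.
Lemma nextK : cancel dnext dprev. Proof. exact: invF_f. Qed.
Lemma prevK : cancel dprev dnext. Proof. exact: f_invF. Qed.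
Lemma org_prev d : org (dprev d) = org d.
Proof. by rewrite -{2}(prevK d) org_next. Qed.

Lemma theta_codir d : codir (phi d + theta d) (phi (dnext d)).
Proof. exact: gap_codir. Qed.
Lemma theta_ge1 d : 1 <= theta d.
Proof.
rewrite /theta; case: (eqVneq d (dnext d)) => [<-|h]; first by rewrite gap_self; lra.
by apply: gap_ge1 => //; rewrite org_next.
Qed.

(* A neighbour strictly inside would split the angle into two angles >= 1. *)
Lemma next_gap d d' : org d' = org d -> gap d d' < 2 ->
  dnext d = d' /\ theta d = gap d d'.
Proof.
move=> ho hg; have l := next_le ho.
case: (eqVneq (dnext d) d') => [e|hn]; first by rewrite /theta e.
have := gap_add d (dnext d) d'.
have h1 : 1 <= gap (dnext d) d' by apply: gap_ge1; rewrite ?org_next.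
have h3 : gap (dnext d) d' + gap d' (dnext d) = 6 by apply: gap_swap;
  rewrite ?org_next.
have /andP[h4 _] := gap_range d' (dnext d).
have := theta_ge1 d; rewrite /theta => h2.
clear hn ho; have /andP[] := gap_range d d'; move=> ? ? []; lra.
Qed.

Definition fnext d := dprev (drev d).
Definition fprev d := drev (dnext d).
Lemma fnextK : cancel fnext fprev.
Proof. by move=> d; rewrite /fnext /fprev prevK revK. Qed.
Lemma fprevK : cancel fprev fnext.
Proof. by move=> d; rewrite /fnext /fprev revK nextK. Qed.
Lemma next_fnext d : dnext (fnext d) = drev d. Proof. exact: prevK. Qed.
Lemma edge_next d : dnext (fnext (dnext (fnext d))) = d.
Proof. by rewrite !next_fnext revK. Qed.

End Darts.

(** * The full turn around a vertex *)

Section Turn.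
Context {R : realType} (V : finType) (X Y : V -> R).
Hypothesis sep : forall v w, v != w -> 1 <= dist2 X Y v w.
Notation dart := (dart X Y).
Notation dnext := (@dnext R V X Y).
Notation theta := (@theta R V X Y).
Notation gap := (@gap R V X Y).
Notation org := (@org R V X Y).

(* Seen from [d0], the position of [dnext d] exceeds that of [d] by [theta d],
   except for the [d] that closes the turn. *)
Lemma turn_sum (A : {set dart}) d0 : d0 \in A ->
  (forall d, d \in A -> org d = org d0) ->
  (forall d, (dnext d \in A) = (d \in A)) ->
  \sum_(d in A) theta d = 6.
Proof.
move=> h0 ho hA.
have step d : d \in A -> d != d0 -> theta d = gap d0 (dnext d) - gap d0 d.
  move=> hd hn; have hod := ho d hd.
  have := gap_add d0 d (dnext d).
  have := next_le (esym hod).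
  have := gap_swap sep (esym hod); rewrite eq_sym => /(_ hn).
  have /andP[] := gap_range d0 (dnext d).
  rewrite -/(theta d); clear; move=> ? ? ? ? []; lra.
have e1 : \sum_(d in A) gap d0 (dnext d) = \sum_(d in A) gap d0 d.
  rewrite [RHS](reindex_inj (next_inj sep)) /=.
  by apply: eq_bigl => d; rewrite hA.
rewrite (bigD1 d0) //= (eq_bigr (fun d => gap d0 (dnext d) - gap d0 d)); last first.
  by move=> d /andP[hd hn]; exact: step.
rewrite sumrB.
have e2 := bigD1 (P := fun d => d \in A) (F := fun d => gap d0 (dnext d)) d0 h0.
have e3 := bigD1 (P := fun d => d \in A) (F := fun d => gap d0 d) d0 h0.
move: e1; rewrite e2 e3 gap_self /= -/(theta d0); lra.
Qed.

Definition darts_at v : {set dart} := [set d | org d == v].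

Lemma turn_at d : \sum_(d' in darts_at (org d)) theta d' = 6.
Proof.
apply: (@turn_sum _ d); rewrite ?inE // => d'; rewrite !inE ?org_next //.
by move/eqP.
Qed.

Lemma turn_orbit d : \sum_(d' in orbit dnext d) theta d' = 6.
Proof.
rewrite -[RHS](@turn_sum [set d' in orbit dnext d] d) ?inE.
- by apply: eq_bigl => d'; rewrite inE.
- by rewrite -fconnect_orbit connect0.
- move=> d'; rewrite inE => /trajectP[i _ ->].
  by elim: i => //= i <-; rewrite org_next.
- move=> d'; rewrite !inE -!fconnect_orbit.
  by rewrite [RHS](same_fconnect1_r (next_inj sep)).
Qed.

(** The angles of the orbit and those of all darts at the vertex both add up to 6; a dart outside
    the orbit would add at least 1. *)
Lemma orbit_dnext d : [set d' in orbit dnext d] = darts_at (org d).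
Proof.
have hs : [set d' in orbit dnext d] \subset darts_at (org d).
  apply/subsetP => d'; rewrite !inE => /trajectP[i _ ->].
  by elim: i => //= i /eqP <-; rewrite org_next.
apply/eqP; rewrite eqEsubset hs /=.
rewrite -setD_eq0; apply: contraT => /set0Pn[d1 hd1].
have := turn_at d; rewrite (big_setID [set d' in orbit dnext d]) /=.
rewrite (setIidPr hs).
have -> : \sum_(i in [set d' in orbit dnext d]) theta i = 6.
  by rewrite -[RHS](turn_orbit d); apply: eq_bigl => d'; rewrite inE.
rewrite (bigD1 d1) //=.
have h1 := theta_ge1 sep d1.
have : 0 <= \sum_(i in darts_at (org d) :\: [set d' in orbit dnext d] | i !=
  d1) theta i.
  by apply: sumr_ge0 => i _; apply: ltW; have /andP[] := theta_range i.
lra.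
Qed.

Lemma order_dnext d : order dnext d = #|darts_at (org d)|.
Proof.
rewrite -orbit_dnext -size_orbit cardsE.
by apply/esym/card_uniqP/orbit_uniq.
Qed.

End Turn.

(** * Distances between the ends of paths of unit edges *)

Section Chords.
Context {R : realType}.
Implicit Types x y z : R.

Lemma cos6B3 x : cos6 (x - 3) = - cos6 x :> R.
Proof. by rewrite -{2}(subrK 3 x) cos6D3 opprK. Qed.
Lemma sin6B3 x : sin6 (x - 3) = - sin6 x :> R.
Proof. by rewrite -{2}(subrK 3 x) sin6D3 opprK. Qed.

Lemma chord3 p q r : (cos6 p - cos6 q + cos6 r) ^+ 2 + (sin6 p - sin6 q + sin6
  r) ^+ 2 =
  3 - 2 * cos6 (p - q) + 2 * cos6 (p - r) - 2 * cos6 (q - r) :> R.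
Proof.
rewrite !cos6B; have := cos6_sin6 p; have := cos6_sin6 q; have := cos6_sin6 r.
move: (cos6 p) (cos6 q) (cos6 r) (sin6 p) (sin6 q) (sin6 r) => a b c a' b' c'
  h1 h2 h3.
have -> : (3 : R) = (a ^+ 2 + a' ^+ 2) + (b ^+ 2 + b' ^+ 2) + (c ^+ 2 + c' ^+ 2).
  by rewrite h1 h2 h3; ring.
ring.
Qed.

(** The four unit vectors pair up into two chords of lengths 2 sin y2 and 2 sin y1, at angle t - y1
    - y2; this is the law of cosines. *)
Lemma chord4 b t y1 y2 :
  (cos6 b - cos6 (b + 2 * y2) + cos6 (b + t - 2 * y1) - cos6 (b + t)) ^+ 2 +
  (sin6 b - sin6 (b + 2 * y2) + sin6 (b + t - 2 * y1) - sin6 (b + t)) ^+ 2 =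
  4 * (sin6 y1 ^+ 2 + sin6 y2 ^+ 2 + 2 * sin6 y1 * sin6 y2 * cos6 (t - y1 - y2)) :> R.
Proof.
pose p := b + y2; pose q := b + t - y1.
have -> : b + 2 * y2 = p + y2 by rewrite /p; ring.
have e1 : b = p - y2 by rewrite /p; ring.
have -> : b + t - 2 * y1 = q - y1 by rewrite /q; ring.
have -> : b + t = q + y1 by rewrite /q; ring.
have -> : t - y1 - y2 = q - p by rewrite /q /p; ring.
have -> : cos6 b = cos6 (p - y2) by rewrite -e1.
have -> : sin6 b = sin6 (p - y2) by rewrite -e1.
clearbody p q; rewrite !cos6B !cos6D !sin6D !cos6N !sin6N.
have := cos6_sin6 p; have := cos6_sin6 q.
move: (cos6 p) (cos6 q) (cos6 y1) (cos6 y2) (sin6 p) (sin6 q) (sin6 y1) (sin6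
  y2) => a c d e a' c' d' e' h1 h2.
transitivity (4 * (d' ^+ 2 * (c ^+ 2 + c' ^+ 2) + e' ^+ 2 * (a ^+ 2 + a' ^+ 2)
   + 2 * d' * e' * (c * a + c' * a'))); first ring.
by rewrite h1 h2; ring.
Qed.

End Chords.

(** * Angles along a face *)

Section Faces.
Context {R : realType} (V : finType) (X Y : V -> R).
Hypothesis sep : forall v w, v != w -> 1 <= dist2 X Y v w.
Notation dart := (dart X Y).
Notation dnext := (@dnext R V X Y).
Notation theta := (@theta R V X Y).
Notation gap := (@gap R V X Y).
Notation org := (@org R V X Y).
Notation tgt := (@tgt R V X Y).
Notation phi := (@phi R V X Y).
Notation drev := (@drev R V X Y).
Notation fnext := (fnext sep).
Notation fprev := (@fprev R V X Y).

Lemma fnextE d g : dnext g = drev d -> fnext d = g.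
Proof. by move=> h; rewrite /fnext -h nextK. Qed.
Lemma org_fnext d : org (fnext d) = tgt d.
Proof. by rewrite /fnext org_prev org_rev. Qed.
Lemma phi_next d : codir (phi (dnext d)) (phi d + theta d).
Proof. exact/codir_sym/theta_codir. Qed.
Lemma phi_fnext d : codir (phi (fnext d)) (phi d + 3 - theta (fnext d)).
Proof.
have h := theta_codir (fnext d); rewrite next_fnext in h.
have := codirD (- theta (fnext d)) (codir_trans h (phi_rev d)).
by rewrite addrK.
Qed.
Lemma phi_fprev d : codir (phi (fprev d)) (phi d + theta d + 3).
Proof. exact: codir_trans (phi_rev _) (codirD 3 (phi_next d)). Qed.

Lemma X_tgt d : X (tgt d) = X (org d) + cos6 (phi d).
Proof. by rewrite cos6_phi; ring. Qed.
Lemma Y_tgt d : Y (tgt d) = Y (org d) + sin6 (phi d).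
Proof. by rewrite sin6_phi; ring. Qed.
Lemma X_tgt_next d : X (tgt (dnext d)) = X (org d) + cos6 (phi d + theta d).
Proof. by rewrite X_tgt org_next; have [-> _] := phi_next d. Qed.
Lemma Y_tgt_next d : Y (tgt (dnext d)) = Y (org d) + sin6 (phi d + theta d).
Proof. by rewrite Y_tgt org_next; have [_ ->] := phi_next d. Qed.
Lemma X_tgt_fnext d :
  X (tgt (fnext d)) = X (org d) + cos6 (phi d) - cos6 (phi d - theta (fnext d)).
Proof.
rewrite X_tgt org_fnext X_tgt; have [-> _] := phi_fnext d.
by have -> : phi d + 3 - theta (fnext d) = phi d - theta (fnext d) + 3;
  [ring|rewrite cos6D3].
Qed.
Lemma Y_tgt_fnext d :
  Y (tgt (fnext d)) = Y (org d) + sin6 (phi d) - sin6 (phi d - theta (fnext d)).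
Proof.
rewrite Y_tgt org_fnext Y_tgt; have [_ ->] := phi_fnext d.
by have -> : phi d + 3 - theta (fnext d) = phi d - theta (fnext d) + 3;
  [ring|rewrite sin6D3].
Qed.

(** The third side is an edge, and an angle below 2 contains no further edge, so this edge is the
    next one of the face. *)
Lemma triangle_step d : theta d = 1 ->
  tgt (fnext d) = tgt (dnext d) /\ theta (fnext d) = 1.
Proof.
move=> h.
have ha : adj X Y (tgt d) (tgt (dnext d)).
  rewrite /adj gap_chord ?org_next // -/(theta d) h cos6_1; apply/eqP; lra.
pose g : dart := mkdart ha.
have hsin : sin6 1 ^+ 2 = 3 / 4 :> R.
  by have := cos6_sin6 (1 : R); rewrite cos6_1; lra.
have hg : gap g (drev d) = 1.
  apply: gapP; first by rewrite ltr01 ler1n.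
  apply: codir_trans (codir_sym (phi_rev d)).
  rewrite /codir cos6D3 sin6D3 cos6D sin6D cos6_1 cos6_phi sin6_phi X_tgt_next
    Y_tgt_next X_tgt Y_tgt h cos6D sin6D cos6_1.
  move: hsin; move: (sin6 1) (cos6 (phi d)) (sin6 (phi d)) => s a b hs; split.
    have : a * s ^+ 2 = a * (3 / 4) by rewrite hs.
    lra.
  have : b * s ^+ 2 = b * (3 / 4) by rewrite hs.
  lra.
have hg2 : gap g (drev d) < 2 by rewrite hg; lra.
have [e1 e2] := @next_gap _ _ _ _ sep g (drev d) erefl hg2.
by rewrite (fnextE e1) e2 hg.
Qed.

Lemma triangle d : theta d = 1 -> fnext (fnext (fnext d)) = d /\ theta (fnext d) = 1.
Proof.
move=> h; have [t1 h1] := triangle_step h; have [t2 h2] := triangle_step h1.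
have [t3 h3] := triangle_step h2; split=> //.
rewrite next_fnext tgt_rev in t2; rewrite next_fnext tgt_rev org_fnext in t3.
by apply: dart_eq; rewrite ?org_fnext ?t2 ?t3.
Qed.

(** Otherwise the outer ends of the path of three edges are closer than 1 and coincide, which closes
    a triangle and makes the angle 1. *)
Lemma theta_pair d : theta d != 1 -> 3 <= theta d + theta (fnext d).
Proof.
move=> hn; rewrite leNgt; apply/negP => hlt.
have g1 := theta_ge1 sep d; have g2 := theta_ge1 sep (fnext d).
have g1' : 1 < theta d by rewrite lt_neqAle eq_sym hn g1.
have hd : dist2 X Y (tgt (dnext d)) (tgt (fnext d)) < 1.
  rewrite /dist2 X_tgt_next Y_tgt_next X_tgt_fnext Y_tgt_fnext.
  have := chord3 (phi d + theta d) (phi d) (phi d - theta (fnext d)).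
  have -> : phi d + theta d - phi d = theta d by ring.
  have -> : phi d + theta d - (phi d - theta (fnext d)) = theta d + theta
    (fnext d) by ring.
  have -> : phi d - (phi d - theta (fnext d)) = theta (fnext d) by ring.
  have := @pair_lt3 _ (theta d) (theta (fnext d)).
  move=> /(_ _ _ hlt) hc e.
  have {}hc : 1 + cos6 (theta d + theta (fnext d)) < cos6 (theta d) + cos6
    (theta (fnext d)).
    by apply: hc; lra.
  apply: le_lt_trans (_ : 3 - 2 * cos6 (theta d) + 2 * cos6 (theta d + theta
    (fnext d))
     - 2 * cos6 (theta (fnext d)) < 1); last by lra.
  rewrite -e le_eqVlt; apply/orP; left; apply/eqP; ring.
have e := lt1_pt sep hd.
have := dartP (fnext d); rewrite org_fnext -e /adj gap_chord ?org_next // => /eqP.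
rewrite -/(theta d) => hc.
have : cos6 (theta d) < cos6 1 by apply: cos6_lt; lra.
by rewrite cos6_1; lra.
Qed.

Lemma theta_fprev_neq1 d : theta d != 1 -> theta (fprev d) != 1.
Proof.
apply: contra => /eqP h; apply/eqP.
by have [_] := triangle h; rewrite fprevK.
Qed.

(** The outer edges are parallel, so their ends are at distance 1. Both angles exceed 1, hence are
    below 2, which lets [next_gap] identify the remaining corners. *)
Lemma theta_rhombus d : theta d != 1 -> theta d + theta (fnext d) = 3 ->
  [/\ fnext (fnext (fnext (fnext d))) = d, theta (fnext (fnext d)) = theta d
    & theta (fnext (fnext (fnext d))) = theta (fnext d)].
Proof.
move=> hn hs.
have g1 := theta_ge1 sep d; have g2 := theta_ge1 sep (fnext d).
have g1' : 1 < theta d by rewrite lt_neqAle eq_sym hn g1.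
have g2' : 1 < theta (fnext d).
  rewrite lt_neqAle eq_sym g2 andbT; apply: contra hn => /eqP h.
  have [e1 e2] := triangle h; have [_ e4] := triangle e2.
  have e5 : fnext (fnext (fnext d)) = d by apply: (can_inj (fnextK sep)).
  by rewrite e5 in e4; apply/eqP.
set t := theta d in hs g1' *; set u := theta (fnext d) in hs g2' *.
pose b := tgt (dnext d); pose c := tgt (fnext d).
have hX : X b - X c = - cos6 (phi d).
  rewrite /b /c X_tgt_next X_tgt_fnext -/t -/u.
  have -> : phi d - u = phi d + t - 3 by lra.
  by rewrite cos6B3; ring.
have hY : Y b - Y c = - sin6 (phi d).
  rewrite /b /c Y_tgt_next Y_tgt_fnext -/t -/u.
  have -> : phi d - u = phi d + t - 3 by lra.
  by rewrite sin6B3; ring.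
have ha : adj X Y c b.
  rewrite adj_sym /adj /dist2 hX hY !sqrrN cos6_sin6 //.
pose g : dart := mkdart ha.
have pg : codir (phi g) (phi d + 3).
  by rewrite /codir cos6D3 sin6D3 cos6_phi sin6_phi -hX -hY.
have h1 : gap g (drev (fnext d)) = t.
  apply: gapP; first by apply/andP; split; lra.
  apply: codir_trans (codir_sym (phi_rev _)).
  apply: codir_trans (codirD t pg) _.
  apply: codir_trans (codirD 3 (codir_sym (phi_fnext d))).
  have -> : phi d + 3 - theta (fnext d) + 3 = phi d + 3 + t by rewrite -/u; lra.
  exact: codir_refl.
have h1' : gap g (drev (fnext d)) < 2 by rewrite h1; lra.
have [e1 e2] := @next_gap _ _ _ _ sep g (drev (fnext d)) erefl h1'.
have f2 : fnext (fnext d) = g by exact: fnextE.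
have h2 : gap (drev (dnext d)) (drev g) = u.
  apply: gapP; first by apply/andP; split; lra.
  apply: codir_trans (codir_sym (phi_rev _)).
  apply: codir_trans (codirD u (phi_rev _)) _.
  apply: codir_trans (codirD u (codirD 3 (phi_next d))) _.
  rewrite -/t; have -> : phi d + t + 3 + u = phi d + 6 by lra.
  apply: codir_trans (codirD 3 (codir_sym pg)).
  have -> : phi d + 3 + 3 = phi d + 6 by ring.
  exact: codir_refl.
have h2' : gap (drev (dnext d)) (drev g) < 2 by rewrite h2; lra.
have [e3 e4] := @next_gap _ _ _ _ sep (drev (dnext d)) (drev g) erefl h2'.
have f3 : fnext (fnext (fnext d)) = drev (dnext d) by rewrite f2; exact: fnextE.
split.
- rewrite f3 -/(fprev d); exact: fprevK.
- by rewrite f2 e2.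
- by rewrite f3 e4.
Qed.

(** Otherwise the ends of the path of four edges around the corner are closer than 1 and coincide.
    Their distance is then 0, which forces [y1 = 0], half the amount by which one pair of angles
    exceeds 3. *)
Lemma theta_open d : theta d != 1 -> theta d + theta (fnext d) != 3 ->
  7 <= 2 * theta d + theta (fnext d) + theta (fprev d).
Proof.
move=> hn hs; rewrite leNgt; apply/negP => hlt.
have p1 := theta_pair hn.
have p2 := theta_pair (theta_fprev_neq1 hn); rewrite fprevK in p2.
have g1 := theta_ge1 sep d; have g2 := theta_ge1 sep (fnext d).
have g3 := theta_ge1 sep (fprev d).
have g1' : 1 < theta d by rewrite lt_neqAle eq_sym hn g1.
set t := theta d in p1 p2 hlt hs g1' *; set u := theta (fnext d) in p1 hlt hs g2 *.
set z := theta (fprev d) in p2 hlt g3 *.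
pose y1 := (t + u - 3) / 2; pose y2 := (t + z - 3) / 2.
have y1_ge0 : 0 <= y1 by rewrite /y1; lra.
have y2_ge0 : 0 <= y2 by rewrite /y2; lra.
have y12 : y1 + y2 < 1 / 2 by rewrite /y1 /y2; lra.
have lb : 1 / 2 <= t - y1 - y2 by rewrite /y1 /y2; lra.
have ub : t - y1 - y2 < 3 by rewrite /y1 /y2; lra.
have [o1 o2] := open_lt1 y1_ge0 y2_ge0 y12 lb ub.
have hX : X (tgt (fnext d)) - X (tgt (dnext (fprev d))) =
    cos6 (phi d) - cos6 (phi d + 2 * y2) + cos6 (phi d + t - 2 * y1) - cos6
      (phi d + t).
  rewrite X_tgt_fnext X_tgt_next -/z -/u org_rev X_tgt_next.
  have [-> _] := codirD z (phi_fprev d); rewrite -/t.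
  have -> : phi d - u = phi d + t - 2 * y1 - 3 by rewrite /y1; field.
  have -> : phi d + t + 3 + z = phi d + 2 * y2 + 3 + 3 by rewrite /y2; field.
  by rewrite cos6B3 !cos6D3; ring.
have hY : Y (tgt (fnext d)) - Y (tgt (dnext (fprev d))) =
    sin6 (phi d) - sin6 (phi d + 2 * y2) + sin6 (phi d + t - 2 * y1) - sin6
      (phi d + t).
  rewrite Y_tgt_fnext Y_tgt_next -/z -/u org_rev Y_tgt_next.
  have [_ ->] := codirD z (phi_fprev d); rewrite -/t.
  have -> : phi d - u = phi d + t - 2 * y1 - 3 by rewrite /y1; field.
  have -> : phi d + t + 3 + z = phi d + 2 * y2 + 3 + 3 by rewrite /y2; field.
  by rewrite sin6B3 !sin6D3; ring.
have hd : dist2 X Y (tgt (fnext d)) (tgt (dnext (fprev d))) = 4 *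
    (sin6 y1 ^+ 2 + sin6 y2 ^+ 2 + 2 * sin6 y1 * sin6 y2 * cos6 (t - y1 - y2)).
  by rewrite -(chord4 (phi d)) /dist2 hX hY.
have e : tgt (fnext d) = tgt (dnext (fprev d)).
  by apply: (lt1_pt sep); rewrite hd; lra.
move: hd; rewrite e {1}/dist2 !subrr expr0n /= addr0 => hd.
have : y1 = 0 by apply: o2; lra.
by move/eqP: hs; rewrite /y1; lra.
Qed.

End Faces.

(** * General position *)

Section Collinear.
Context {R : realType} (V : finType) (X Y : V -> R).
Hypothesis sep : forall v w, v != w -> 1 <= dist2 X Y v w.
Hypothesis gp : forall a b c, a != b -> b != c -> a != c ->
  (X b - X a) * (Y c - Y a) - (X c - X a) * (Y b - Y a) != 0.
Notation dart := (dart X Y).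
Notation dnext := (@dnext R V X Y).
Notation theta := (@theta R V X Y).
Notation org := (@org R V X Y).
Notation tgt := (@tgt R V X Y).
Notation phi := (@phi R V X Y).
Notation drev := (@drev R V X Y).
Notation fnext := (fnext sep).
Notation fprev := (@fprev R V X Y).
Notation dprev := (dprev sep).

Lemma no_midpoint (a b c : V) : a != b ->
  X c - X b = X b - X a -> Y c - Y b = Y b - Y a -> False.
Proof.
move=> hn hX hY.
have e2 z : z + z = 0 -> z = 0 :> R by lra.
have hbc : b != c.
  apply: contra hn => /eqP e; apply/eqP/(eq_pt sep); move: hX hY; rewrite e; lra.
have hac : a != c.
  apply: contra hn => /eqP e; apply/eqP/(eq_pt sep); move: hX hY; rewrite e; lra.
have /eqP := gp hn hbc hac; apply.
have -> : X c = X b + (X b - X a) by lra.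
have -> : Y c = Y b + (Y b - Y a) by lra.
ring.
Qed.

Lemma theta_fan d : theta d = 1 -> theta (dnext d) = 1 ->
  theta (dnext (dnext d)) != 1.
Proof.
move=> h1 h2; apply/eqP => h3.
pose d3 := dnext (dnext (dnext d)).
have hp : codir (phi d3) (phi d + 3).
  apply: codir_trans (phi_next _) _; rewrite h3.
  apply: codir_trans (codirD 1 (phi_next _)) _; rewrite h2.
  apply: codir_trans (codirD 1 (codirD 1 (phi_next _))) _; rewrite h1.
  have -> : phi d + 1 + 1 + 1 = phi d + 3 by ring.
  exact: codir_refl.
have ho : org d3 = org d by rewrite !org_next.
case: hp; rewrite cos6D3 sin6D3 => hC hS.
apply: (@no_midpoint (tgt d3) (org d) (tgt d)).
- apply/eqP => e; have := dartP d3; rewrite /adj e ho /dist2 !subrr expr0n /= addr0.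
  by rewrite eq_sym oner_eq0.
- by rewrite (X_tgt d3) (X_tgt d) ho hC; ring.
- by rewrite (Y_tgt d3) (Y_tgt d) ho hS; ring.
Qed.

(** For the path x, y, a, c, r the darts are y -> a, y -> x, a -> c and c -> r. *)
Lemma no_bent (p1 p2 p3 p4 : dart) :
  org p2 = org p1 -> org p3 = tgt p1 -> org p4 = tgt p3 -> p1 <> p2 ->
  codir (phi p3) (phi p2 + 3) -> codir (phi p4) (phi p1) -> False.
Proof.
move=> h2 h3 h4 hn [c3 s3] [c4 s4].
rewrite cos6D3 in c3; rewrite sin6D3 in s3.
apply: (@no_midpoint (tgt p2) (tgt p1) (tgt p4)).
- by apply/eqP => e; apply: hn; apply: dart_eq.
- by rewrite (X_tgt p4) h4 (X_tgt p3) h3 c3 c4 (X_tgt p2) (X_tgt p1) h2; ring.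
- by rewrite (Y_tgt p4) h4 (Y_tgt p3) h3 s3 s4 (Y_tgt p2) (Y_tgt p1) h2; ring.
Qed.

Lemma org_iter k (d : dart) : org (iter k dnext d) = org d.
Proof. by elim: k => //= k <-; rewrite org_next. Qed.
Lemma org_iter_prev k (d : dart) : org (iter k dprev d) = org d.
Proof. by elim: k => //= k <-; rewrite org_prev. Qed.

Lemma sweepS (s : dart -> dart) (d : dart) k :
  sweep s theta d k.+1 = sweep s theta d k + theta (iter k s d).
Proof. by rewrite /sweep big_ord_recr. Qed.
Lemma sweep_ge1 (s : dart -> dart) d k : (0 < k)%N -> 1 <= sweep s theta d k.
Proof.
case: k => // k _; rewrite sweepS.
have : 0 <= sweep s theta d k.
  by apply: sumr_ge0 => i _; have := theta_ge1 sep (iter i s d); lra.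
have := theta_ge1 sep (iter k s d); lra.
Qed.

Lemma phi_iter k (d : dart) : codir (phi (iter k dnext d)) (phi d + sweep dnext
  theta d k).
Proof.
elim: k => [|k IH]; first by rewrite /sweep big_ord0 addr0.
apply: codir_trans (phi_next _) _.
by rewrite sweepS addrA; apply: codirD.
Qed.
Lemma phi_iter_prev k (d : dart) :
  codir (phi (dnext (iter k dprev d))) (phi (dnext d) - sweep dprev theta d k).
Proof.
elim: k => [|k IH]; first by rewrite /sweep big_ord0 subr0.
rewrite iterS prevK sweepS opprD addrA.
have h := codirD (- theta (iter k dprev d)) (phi_next (iter k dprev d)).
rewrite addrK in h.
exact: codir_trans (codir_sym h) (codirD _ IH).
Qed.

(** This excludes the degenerate path with x = a: two turns that are at least 1 and add up to 6 are
    at most 5. *)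
Lemma not_full_turn (x y : R) : 1 <= y -> y <= 5 ->
  ~ codir x (x + y) /\ ~ codir x (x - y).
Proof.
move=> h1 h2; split=> h.
  have := codirD (- x) h; rewrite subrr addrAC subrr add0r => h0.
  have e : 0 = y by apply: codir_eq h0; rewrite ?lexx ?ltr0n //; lra.
  by rewrite -e in h1; lra.
have := codirD (y - x) h.
have -> : x - y + (y - x) = 0 by ring.
have -> : x + (y - x) = y by ring.
move=> h0.
have e : y = 0 by apply: codir_eq h0; rewrite ?lexx ?ltr0n //; lra.
by rewrite e in h1; lra.
Qed.

Lemma no_path_ccw c k l m : ~ bent_path dnext fnext theta c k l m.
Proof.
rewrite /bent_path !next_fnext => -[k0 m0 hA hB].
have A1 := sweep_ge1 dnext c k0.
set p3 := iter l dnext (drev c) in hA hB *.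
have sw1 := sweep_ge1 dnext (drev p3) m0.
have h3 := phi_iter l (drev c); rewrite -/p3 in h3.
have h4 := phi_iter m (drev p3).
apply: (@no_bent c (iter k dnext c) p3 (iter m dnext (drev p3))).
- exact: org_iter.
- by rewrite /p3 org_iter org_rev.
- by rewrite org_iter org_rev.
- move=> e; have := phi_iter k c; rewrite -e.
  have [] := @not_full_turn (phi c) (sweep dnext theta c k) A1 _ => //; lra.
- apply: codir_trans h3 _; rewrite -hA.
  apply: codir_trans (codirD _ (phi_rev c)) _.
  rewrite addrAC; exact/codir_sym/codirD/phi_iter.
- apply: codir_trans h4 _.
  apply: codir_trans (codirD _ (phi_rev p3)) _.
  apply: codir_trans (codirD _ (codirD 3 h3)) _.
  apply: codir_trans (codirD _ (codirD 3 (codirD _ (phi_rev c)))) _.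
  set u := sweep _ _ _ l in hA hB *; set v := sweep _ _ _ m in hB *.
  have -> : phi c + 3 + u + 3 + v = phi c + 6 + 6 by lra.
  exact: codir_trans (codir6 _) (codir6 _).
Qed.

Lemma no_path_cw c k l m : ~ bent_path dprev fprev theta c k l m.
Proof.
rewrite /bent_path => -[k0 m0 hA hB].
set c1 := dprev (fprev c) in hA hB *.
have e1 : dnext c1 = drev (dnext c) by rewrite /c1 prevK.
set z := iter l dprev c1 in hB *.
set c2 := dprev (fprev z) in hB *.
have e2 : dnext c2 = drev (dnext z) by rewrite /c2 prevK.
have A1 := sweep_ge1 dprev c k0.
have sw1 := sweep_ge1 dprev c2 m0.
have h3 := phi_iter_prev l c1; rewrite -/z e1 in h3.
have h4 := phi_iter_prev m c2; rewrite e2 in h4.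
apply: (@no_bent (dnext c) (dnext (iter k dprev c)) (dnext z) (dnext (iter m
  dprev c2))).
- by rewrite !org_next org_iter_prev.
- by rewrite org_next /z org_iter_prev /c1 org_prev.
- by rewrite org_next org_iter_prev /c2 org_prev.
- move=> e; have := phi_iter_prev k c; rewrite -e.
  have [] := @not_full_turn (phi (dnext c)) (sweep dprev theta c k) A1 _ => //; lra.
- apply: codir_trans h3 _; rewrite -hA.
  apply: codir_trans (codirD _ (phi_rev (dnext c))) _.
  rewrite addrAC; exact/codir_sym/codirD/phi_iter_prev.
- apply: codir_trans h4 _.
  apply: codir_trans (codirD _ (phi_rev (dnext z))) _.
  apply: codir_trans (codirD _ (codirD 3 h3)) _.
  apply: codir_trans (codirD _ (codirD 3 (codirD _ (phi_rev (dnext c))))) _.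
  set u := sweep _ _ _ l in hA hB *; set v := sweep _ _ _ m in hB *.
  have -> : phi (dnext c) + 3 - u + 3 - v = phi (dnext c) by lra.
  exact: codir_refl.
Qed.

Hypothesis min_deg3 : forall v, (3 <= #|darts_at X Y v|)%N.

Definition deg_at d : nat := #|darts_at X Y (org d)|.
Lemma deg_at_next d : deg_at (dnext d) = deg_at d.
Proof. by rewrite /deg_at org_next. Qed.

Lemma deg_at_le5 d : (deg_at d <= 5)%N.
Proof.
have h := turn_at sep d; set A := darts_at X Y (org d) in h.
have hA : \sum_(d' in A) (theta d' - 1) = 6 - (deg_at d)%:R.
  by rewrite sumrB h sumr_const.
have ge0 d' : d' \in A -> 0 <= theta d' - 1.
  by move=> _; rewrite subr_ge0; exact: theta_ge1.
have le6 : (deg_at d <= 6)%N.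
  by rewrite -(ler_nat R) -subr_ge0 -hA; exact: sumr_ge0.
rewrite leqNgt; apply/negP => gt5.
have e6 : deg_at d = 6 by apply/eqP; rewrite eqn_leq le6.
rewrite e6 subrr in hA.
have th1 d' : org d' = org d -> theta d' = 1.
  move=> ho; apply/eqP; rewrite -subr_eq0; apply/eqP.
  by apply: (psumr_eq0P ge0 hA); rewrite inE ho.
by have := theta_fan (th1 d erefl) (th1 _ (org_next d));
  rewrite th1 ?eqxx // !org_next.
Qed.

Lemma turn_iter d :
  \sum_(i < deg_at d) theta (iter i dnext d) = 6 /\ iter (deg_at d) dnext d = d.
Proof.
have e : deg_at d = order dnext d by rewrite (order_dnext sep).
split; last by rewrite e iter_order //; exact: next_inj.
rewrite -[RHS](turn_orbit sep d) e.
rewrite -(big_uniq _ (orbit_uniq dnext d)) /orbit (big_nth d) size_traject big_mkord.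
by apply: eq_bigr => i _; rewrite nth_traject.
Qed.

Lemma deg_atP d :
  [\/ [/\ deg_at d = 3%N, dnext (dnext d) = dprev d
        & theta d + theta (dnext d) + theta (dprev d) = 6],
      [/\ deg_at d = 4%N, dnext (dnext d) = dprev (dprev d)
        & theta d + theta (dnext d) + theta (dprev d) + theta (dnext (dnext d)) = 6]
    | [/\ deg_at d = 5%N, dnext (dnext (dnext d)) = dprev (dprev d)
        & theta d + theta (dnext d) + theta (dprev d) + theta (dnext (dnext d))
          + theta (dprev (dprev d)) = 6]].
Proof.
have [hs hi] := turn_iter d; have l5 := deg_at_le5 d; have l3 := min_deg3 (org d).
rewrite -/(deg_at d) in l3; move: hs hi l3 l5.
case: (deg_at d) => [|[|[|[|[|[|]]]]]] //= hs hi _ _;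
  [constructor 1|constructor 2|constructor 3];
  rewrite !big_ord_recl big_ord0 /= in hs.
- have e : dnext (dnext d) = dprev d by rewrite -{2}hi nextK.
  by split=> //; rewrite -e; lra.
- have e : dnext (dnext (dnext d)) = dprev d by rewrite -{2}hi nextK.
  have e' : dnext (dnext d) = dprev (dprev d) by rewrite -e nextK.
  by split=> //; rewrite -e; lra.
- have e : dnext (dnext (dnext (dnext d))) = dprev d by rewrite -{2}hi nextK.
  have e' : dnext (dnext (dnext d)) = dprev (dprev d) by rewrite -e nextK.
  by split=> //; rewrite -e' -e; lra.
Qed.

Definition penny_map : angle_map R dart :=
  AngleMap (nextK sep) (prevK sep) (fnextK sep) (fprevK sep) (edge_next sep)
    deg_at_next deg_atP (theta_ge1 sep) (@triangle _ _ _ _ sep) (@theta_pair _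
      _ _ _ sep)
    (@theta_rhombus _ _ _ _ sep) (@theta_open _ _ _ _ sep) theta_fan
      no_path_ccw no_path_cw.

Lemma dart_bound : (9 * #|{: dart}| <= 43 * #|V|)%N.
Proof.
rewrite -(ler_nat R) !natrM.
(* Every vertex has a dart, so its inverse degrees add up to 1. *)
have -> : #|V|%:R = \sum_(d : dart) (deg_at d)%:R^-1 :> R.
  rewrite (partition_big org predT) //= -sum1_card natr_sum.
  apply: eq_bigr => v _.
  rewrite (eq_bigr (fun _ => #|darts_at X Y v|%:R^-1)); last first.
    by move=> d /eqP <-.
  transitivity (\sum_(d in darts_at X Y v) #|darts_at X Y v|%:R^-1 : R); last first.
    by apply: eq_bigl => d; rewrite inE.
  rewrite sumr_const -[RHS]mulr_natr mulVf // pnatr_eq0.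
  by case: #|_| (min_deg3 v).
exact: angle_map_bound penny_map.
Qed.

End Collinear.

(** * Penny graphs in the plane *)

Section Plane.
Context {R : realType}.
Implicit Types (P : {fset 'rV[R]_2}) (p q r : 'rV[R]_2).

Lemma edistE p q : edist p q = Num.sqrt ((p 0 0 - q 0 0) ^+ 2 + (p 0 1 - q 0 1) ^+ 2).
Proof.
rewrite /edist !big_ord_recl big_ord0 addr0.
by rewrite (_ : lift ord0 ord0 = 1) //; apply: val_inj.
Qed.

Lemma edist_eq1 p q :
  (edist p q == 1) = ((p 0 0 - q 0 0) ^+ 2 + (p 0 1 - q 0 1) ^+ 2 == 1).
Proof. by rewrite edistE -{1}sqrtr1 eqr_sqrt // addr_ge0 // sqr_ge0. Qed.

Lemma edist_ge1 p q :
  (1 <= edist p q) = (1 <= (p 0 0 - q 0 0) ^+ 2 + (p 0 1 - q 0 1) ^+ 2).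
Proof. by rewrite edistE -{1}sqrtr1 ler_sqrt // addr_ge0 // sqr_ge0. Qed.

Lemma edistC p q : edist p q = edist q p.
Proof. by rewrite !edistE; congr Num.sqrt; ring. Qed.

Lemma edist_neq p q : edist p q == 1 -> p != q.
Proof.
by apply: contraTneq => ->; rewrite edist_eq1 !subrr expr0n /= addr0 eq_sym oner_eq0.
Qed.

Lemma rV2_eq p q : p 0 0 = q 0 0 -> p 0 1 = q 0 1 -> p = q.
Proof.
move=> h0 h1; apply/rowP => i; case: i => [[|[|//]] hi].
- by rewrite (_ : Ordinal hi = 0) //; apply: val_inj.
- by rewrite (_ : Ordinal hi = 1) //; apply: val_inj.
Qed.

Lemma det0_collinear3 p q r : p != q ->
  (q 0 0 - p 0 0) * (r 0 1 - p 0 1) - (r 0 0 - p 0 0) * (q 0 1 - p 0 1) = 0 ->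
  collinear3 p q r.
Proof.
move=> hn h; exists p, (q - p); split; first by rewrite subr_eq0 eq_sym.
split; [by exists 0; rewrite scale0r addr0|by exists 1; rewrite scale1r addrC subrK|].
case: (eqVneq (q 0 0) (p 0 0)) => [e|e].
  have e1 : q 0 1 - p 0 1 != 0.
    by rewrite subr_eq0; apply: contra hn => /eqP e1; apply/eqP/rV2_eq.
  exists ((r 0 1 - p 0 1) / (q 0 1 - p 0 1)).
  apply: rV2_eq; rewrite !mxE; last by rewrite divfK // addrC subrK.
  rewrite e subrr mulr0 addr0; move/eqP: h.
  by rewrite e subrr mul0r sub0r oppr_eq0 mulf_eq0 (negbTE e1) orbF subr_eq0 => /eqP.
have e1 : q 0 0 - p 0 0 != 0 by rewrite subr_eq0.
exists ((r 0 0 - p 0 0) / (q 0 0 - p 0 0)).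
apply: rV2_eq; rewrite !mxE; first by rewrite divfK // addrC subrK.
apply: (mulfI e1); rewrite mulrDr mulrA [_ * (_ / _)]mulrC divfK //.
by move/eqP: h; rewrite subr_eq0 => /eqP <-; ring.
Qed.

Lemma penny_edgesP P e :
  reflect (exists p q, [/\ p \in P, q \in P, edist p q == 1 & e = [fset p; q]])
    (e \in penny_edges P).
Proof.
apply: (iffP (imfset2P _ _ _ _ _)) => /= [[p hp [q]]|[p [q [hp hq h ->]]]].
  by rewrite inE => /andP[hq h] ->; exists p, q.
by exists p => //; exists q => //; rewrite inE hq.
Qed.

Lemma sub_penny_vertices P Q : Q `<=` P -> penny_vertices P -> penny_vertices Q.
Proof. by move=> /fsubsetP h hP p q hp hq; apply: hP; apply: h. Qed.

Lemma sub_general_position P Q : Q `<=` P -> general_position P -> general_position Q.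
Proof. by move=> /fsubsetP h hP p q r hp hq hr; apply: hP; apply: h. Qed.

Definition neighbours P p : {fset 'rV[R]_2} := [fset q in P | edist p q == 1].

Lemma penny_edges_remove P p : p \in P ->
  (#|` penny_edges P| <= #|` penny_edges (P `\ p)| + #|` neighbours P p|)%N.
Proof.
move=> hp.
have hs : penny_edges P `<=`
    penny_edges (P `\ p) `|` [fset [fset p; q] | q in neighbours P p].
  apply/fsubsetP => e /penny_edgesP[a [b [ha hb hab ->]]]; rewrite inE.
  case: (eqVneq a p) => [ea|na].
    apply/orP; right; apply/imfsetP; exists b; last by rewrite ea.
    by rewrite !inE /= hb -ea.
  case: (eqVneq b p) => [eb|nb].
    apply/orP; right; apply/imfsetP; exists a; last by rewrite eb fsetUC.
    by rewrite !inE /= ha -eb edistC.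
  by apply/orP; left; apply/penny_edgesP; exists a, b; rewrite !inE na nb.
apply: leq_trans (fsubset_leq_card hs) _.
apply: leq_trans (leq_card_fsetU _ _) _.
by rewrite leq_add2l; exact: leq_imfset_card.
Qed.

Section Penny.
Variable P : {fset 'rV[R]_2}.
Hypotheses (penny : penny_vertices P) (gpos : general_position P).
Let X (v : P) : R := val v 0 0.
Let Y (v : P) : R := val v 0 1.

Lemma penny_sep v w : v != w -> 1 <= dist2 X Y v w.
Proof.
move=> h; rewrite /dist2 -edist_ge1; apply: penny; [exact: valP|exact: valP|].
by rewrite (inj_eq val_inj).
Qed.

Lemma penny_gp a b c : a != b -> b != c -> a != c ->
  (X b - X a) * (Y c - Y a) - (X c - X a) * (Y b - Y a) != 0.
Proof.
rewrite -!(inj_eq val_inj) => hab hbc hac; apply/eqP => h.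
exact: gpos (valP a) (valP b) (valP c) hab hbc hac (det0_collinear3 hab h).
Qed.

Lemma adjE v w : adj X Y v w = (edist (val v) (val w) == 1).
Proof. by rewrite edist_eq1. Qed.

Lemma neighbours_darts_at v : (#|` neighbours P (val v)| <= #|darts_at X Y v|)%N.
Proof.
rewrite cardE -(size_map (fun d => val (tgt d))).
apply: uniq_leq_size; first exact: fset_uniq.
move=> q; rewrite !inE /= => /andP[hq h].
have ha : adj X Y v [` hq] by rewrite adjE.
by apply/mapP; exists (mkdart ha); rewrite ?mem_enum ?inE.
Qed.

(** Each edge is sent to a chosen dart and to its reverse, which differ because the ends of an edge
    differ. *)
Lemma penny_edges_dart : (2 * #|` penny_edges P| <= #|{: dart X Y}|)%N.
Proof.
pose g (d : dart X Y) := [fset val (org d); val (tgt d)].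
have ex (e : penny_edges P) : exists d, g d == val e.
  have /penny_edgesP[p [q [hp hq h he]]] := valP e.
  have ha : adj X Y [` hp] [` hq] by rewrite adjE.
  by exists (mkdart ha); rewrite he.
pose k (x : penny_edges P * bool) :=
  if x.2 then xchoose (ex x.1) else drev (xchoose (ex x.1)).
have gk x : g (k x) = val x.1.
  have /eqP h := xchooseP (ex x.1).
  by rewrite /k; case: x.2; rewrite -[RHS]h //; exact: fsetUC.
have kinj : injective k.
  move=> [e b] [e' b'] h.
  have e1 : e = e' by apply: val_inj; rewrite -(gk (e, b)) h gk.
  rewrite -{e'}e1 in h *; congr (_, _).
  have hd : xchoose (ex e) <> drev (xchoose (ex e)).
    move=> /(congr1 (fun d => org d)); rewrite org_rev => ho.
    by have := dartP (xchoose (ex e)); rewrite adjE => /edist_neq; rewrite ho eqxx.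
  by move: h; rewrite /k; case: b; case: b' => //= h; case: hd.
by have := leq_card k kinj; rewrite card_prod card_bool mulnC cardfE.
Qed.

Lemma penny_min_degree3 : (forall p, p \in P -> (3 <= #|` neighbours P p|)%N) ->
  (18 * #|` penny_edges P| <= 43 * #|` P|)%N.
Proof.
move=> h; have h3 v : (3 <= #|darts_at X Y v|)%N.
  exact: leq_trans (h _ (valP v)) (neighbours_darts_at v).
rewrite (cardfE P); apply: leq_trans (dart_bound penny_sep penny_gp h3).
by rewrite (_ : 18 = 9 * 2)%N // -mulnA leq_mul2l penny_edges_dart.
Qed.

End Penny.

Lemma penny_edges_le P : penny_vertices P -> general_position P ->
  (18 * #|` penny_edges P| <= 43 * #|` P|)%N.
Proof.
have [n] := ubnP #|` P|; elim: n P => // n IH P hn hP hg.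
case: (boolP [forall v : P, 3 <= #|` neighbours P (val v)|]%N) => [/forallP h|].
  by apply: penny_min_degree3 => // p hp; exact: (h [` hp]).
rewrite negb_forall => /existsP[v]; rewrite -ltnNge => hv.
have hs : P `\ val v `<=` P by exact: fsubD1set.
have hc : #|` P| = #|` P `\ val v|.+1 by rewrite (cardfsD1 (val v)) (fsvalP v).
have /IH := sub_penny_vertices hs hP; rewrite -ltnS -hc => /(_ hn).
move=> /(_ (sub_general_position hs hg)).
have := penny_edges_remove (valP v); rewrite hc.
move: #|` _| #|` _| #|` _| #|` _| hv => a b c d; lia.
Qed.

End Plane.

Theorem theorem3 (R : realType) (n : nat) (P : {fset 'rV[R]_2}) :
  #|` P| = n -> penny_vertices P -> general_position P ->
  (#|` penny_edges P|%:R : R) <= 43%:R * n%:R / 18%:R.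
Proof.
move=> <- hP hg; rewrite ler_pdivlMr ?ltr0n // mulrC -!natrM ler_nat.
exact: penny_edges_le.
Qed.
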